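(* Let $a, b \in \mathbb{C}\setminus\{0\}$, $c>0$ and $c>|a|+|b|+1$. If $$\frac{\Gamma(c)\,\Gamma(c-|a|-|b|)}{\Gamma(c-|a|)\,\Gamma(c-|b|)}\left[\frac{2\,|a|\,(|b|)_2}{(c-|a|)(c-|a|-|b|-1)}\;{}_2F_1(|a|+1,|b|+2;c-|a|+1;-1)+{}_2F_1(|a|,|b|;c-|a|;-1)\right]\le2,$$ then the function $z\,{}_3F_2\left(a,\frac b2,\frac{b+1}2;\frac c2,\frac{c+1}2;z\right)$ belongs to the class $\mathcal{S}_p$.
   Context: $\mathbb{D}=\{z\in\mathbb{C}:|z|<1\}$. $\mathcal{A}$ is the family of analytic functions $f$ on $\mathbb{D}$ of the form $f(z)=z+\sum_{n\ge2}a_nz^n$. $\mathcal{S}^*$ is the class of univalent $f\in\mathcal{A}$ that are starlike with respect to the origin. $\mathcal{UCV}$ is the class of uniformly convex functions: $f\in\mathcal{A}$ is in $\mathcal{UCV}$ if and only if $\operatorname{Re}\left(1+\frac{(z-\zeta)f''(z)}{f'(z)}\right)>0$ for all $z,\zeta\in\mathbb{D}$. $\mathcal{S}_p=\{F\in\mathcal{S}^*: F(z)=zf'(z),\ f\in\mathcal{UCV}\}$. Pochhammer symbol: $(x)_0=1$, $(x)_n=x(x+1)\cdots(x+n-1)$ for $n\ge1$. Clausen's hypergeometric function is ${}_3F_2(a,b,c;d,e;z)=\sum_{n=0}^\infty\frac{(a)_n(b)_n(c)_n}{(d)_n(e)_n(1)_n}z^n$ for $|z|<1$, with $d,e\ne0,-1,-2,\dots$.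 ${}_2F_1(a,b;c;z)$ is the Gauss hypergeometric function, i.e. $\sum_{n\ge0}\frac{(a)_n(b)_n}{(c)_n(1)_n}z^n$ for $|z|<1$, continued analytically to $\mathbb{C}\setminus[1,\infty)$ (so its value at $-1$ makes sense). *)

(* Defs.v *)
From Stdlib Require Import Reals.
From Coquelicot Require Export Coquelicot.
Open Scope R_scope.

Definition disc (z : C) : Prop := Cmod z < 1.

(* Members are total functions C -> C of which only the values
   on the disc matter, here and in all the classes below. *)
Definition class_A (f : C -> C) : Prop :=
  exists a : nat -> C,
    a 0%nat = RtoC 0 /\ a 1%nat = RtoC 1 /\
    forall z, disc z -> is_pseries (K := C_AbsRing) (V := C_NormedModule) a z (f z).

Definition univalent (f : C -> C) : Prop :=
  forall z w, disc z -> disc w -> f z = f w -> z = w.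

(* The image f(D) contains the segment from the origin to each of its points. *)
Definition starlike_image (f : C -> C) : Prop :=
  forall (z : C) (t : R), disc z -> 0 <= t <= 1 ->
    exists w, disc w /\ f w = (t * f z)%C.

Definition class_Sstar (f : C -> C) : Prop :=
  class_A f /\ univalent f /\ starlike_image f.

(* Coquelicot's division is total, with x / 0 = 0, so the nonvanishing of f',
   implicit in the quotient f'' / f', has to be stated. *)
Definition class_UCV (f : C -> C) : Prop :=
  class_A f /\
  (forall z, disc z -> C_derive f z <> RtoC 0) /\
  (forall z zeta, disc z -> disc zeta ->
     0 < Re (1 + (z - zeta) * C_derive (C_derive f) z / C_derive f z)%C).

Definition class_Sp (F : C -> C) : Prop :=
  class_Sstar F /\
  exists f, class_UCV f /\ forall z, disc z -> F z = (z * C_derive f z)%C.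

Fixpoint poch (x : C) (n : nat) : C :=
  match n with
  | O => RtoC 1
  | S m => (poch x m * (x + INR m))%C
  end.

Definition hyp3F2_coef (a b c d e : C) (n : nat) : C :=
  (poch a n * poch b n * poch c n / (poch d n * poch e n * poch 1 n))%C.

(* The sum of the series, for z in the disc; unspecified where it diverges. *)
Definition hyp3F2 (a b c d e z : C) : C :=
  iota (T := C_CompleteNormedModule)
    (is_pseries (K := C_AbsRing) (V := C_NormedModule) (hyp3F2_coef a b c d e) z).

Definition hyp2F1_coef (a b c : C) (n : nat) : C :=
  (poch a n * poch b n / (poch c n * poch 1 n))%C.

Definition slit_plane (z : C) : Prop := ~ (Im z = 0 /\ 1 <= Re z).

(* F is 2F1(a,b;c;.), i.e. the analytic continuation of the Gauss series to the
   slit plane.  The slit plane being connected, this determines F on it. *)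
Definition is_hyp2F1 (a b c : C) (F : C -> C) : Prop :=
  (forall z, disc z ->
     is_pseries (K := C_AbsRing) (V := C_NormedModule) (hyp2F1_coef a b c) z (F z)) /\
  (forall z, slit_plane z -> ex_derive (K := C_AbsRing) (V := C_NormedModule) F z).

(* Euler's integral, for x > 0 *)
Definition Gamma (x : R) : R :=
  RInt_gen (fun t => Rpower t (x - 1) * exp (- t)) (at_right 0) (Rbar_locally p_infty).

(* Main.v *)
Require Import Defs.
From Stdlib Require Import Reals Lra Lia Factorial.
From Coquelicot Require Import Coquelicot.
Open Scope R_scope.

(* Write A = |a|, B = |b|. Since (b)_(2n) = 4^n (b/2)_n ((b+1)/2)_n, the coefficient g_n of
   the Clausen series is (a)_n (b)_(2n) / ((c)_(2n) n!), which is at most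
   q_n = (A)_n (B)_(2n) / ((c)_(2n) n!) in modulus.

   (1) If g_0 = 1 and sum_(n>=1) (2n+1) |g_n| <= 1, then z g(z) is in S_p: the uniform convexity
   condition reduces to 2 |g'| <= |g|, and univalence and starlikeness follow from
   Lipschitz and fixed point arguments on z g(z) = z + (small).

   (2) sum (2n+1) q_n <= 2. As sum n q_n is a multiple of sum q_n for the parameters
   (A+1, B+2, c+2), it suffices that sum q_n is at most the Gamma quotient times F(-1), F being
   the Gauss function 2F1(A, B; c-A; .). Let d_N(x) be the coefficient of t^N in
   (1 - t)^(-A) (1 + x t)^(-A). By Gauss's summation in one variable,
   sum_N (B)_N/(c)_N d_N(x) = 2F1(A, B; c; 1) F(-x) for 0 <= x < 1. All d_N(x) are nonnegative
   and d_(2m)(1) = (A)_m/m!, so x -> 1 bounds sum q_n by 2F1(A, B; c; 1) F(-1). Finally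
   2F1(A, B; c; 1) is compared with the Gamma quotient by their common recurrence in c and
   the log-convexity of Gamma. *)

(** * Absolutely convergent complex series *)

(** The [d_N] come from a Beta integral: [(B)_N/(c)_N] is the N-th moment of the Beta distribution
    with parameters [B] and [c - B], so [sum_N (B)_N/(c)_N d_N(x)] is the mean of
    [(1 - t)^(-A) (1 + x t)^(-A)]; at [x = 1] this is [(1 - t^2)^(-A)], whose mean is [sum q_n]. The
    proof itself works with the series alone. The obstacle is the point -1. Under [c > A + B + 1]
    the number [c - 2A - B] can be less than -1; then the Gauss series of [F] diverges at -1 and
    [F(-1)] exists only by continuation. Hence the detour through [x < 1], where the double series
    converges absolutely. The weight [2n + 1] encodes [2 sum n |g_n| <= 1 - sum |g_n|] over
    [n >= 1]: with [f' = g] the quotient [f''/f'] is [g'/g], and [|z - zeta| < 2]. The 1 in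
    [c > A + B + 1] pays for the factor [n]: the shifted parameters have [(c + 2) - (A + 1) - (B +
    2) = c - A - B - 1]. *)

Notation is_cseries := (is_series (K := C_AbsRing) (V := C_NormedModule)).

Lemma ex_series_le_R (u b : nat -> R) :
  (forall n, Rabs (u n) <= b n) -> ex_series b -> ex_series u.
Proof. exact (ex_series_le (V := R_CompleteNormedModule) u b). Qed.

Definition summable (u : nat -> C) : Prop := ex_series (fun n => Cmod (u n)).

(** Taken componentwise because [Series] is real-valued; meaningful for [summable] sequences. *)
Definition csum (u : nat -> C) : C :=
  (Series (fun n => Re (u n)), Series (fun n => Im (u n))).

Lemma im_le_Cmod (z : C) : Rabs (Im z) <= Cmod z.
Proof.
  apply Rle_trans with (2 := Rmax_Cmod z). apply Rmax_r.
Qed.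

Lemma sum_n_C (u : nat -> C) (n : nat) :
  sum_n (G := C_NormedModule) u n =
  (sum_n (fun k => Re (u k)) n, sum_n (fun k => Im (u k)) n).
Proof.
  induction n as [|n IH].
  - rewrite !sum_O. destruct (u 0%nat); reflexivity.
  - rewrite !sum_Sn, IH. destruct (u (S n)); reflexivity.
Qed.

Lemma csum_correct (u : nat -> C) : summable u -> is_cseries u (csum u).
Proof.
  intros Hu.
  assert (Hr : ex_series (fun n => Re (u n))).
  { apply ex_series_le_R with (2 := Hu). intros n. apply re_le_Cmod. }
  assert (Hi : ex_series (fun n => Im (u n))).
  { apply ex_series_le_R with (2 := Hu). intros n. apply im_le_Cmod. }
  apply Series_correct in Hr. apply Series_correct in Hi.
  unfold is_series.
  (* The uniform structure of [C] is that of the product of two copies of [R], so it suffices that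
     both components are close. *)
  apply filterlim_locally. intros eps.
  generalize (proj1 (filterlim_locally _ _) Hr eps) (proj1 (filterlim_locally _ _) Hi eps).
  intros H1 H2. generalize (filter_and _ _ H1 H2). apply filter_imp.
  intros n [B1 B2]. rewrite sum_n_C. split; assumption.
Qed.

Lemma is_cseries_unique (u : nat -> C) (l1 l2 : C) :
  is_cseries u l1 -> is_cseries u l2 -> l1 = l2.
Proof. intros H1 H2. exact (filterlim_locally_unique _ _ _ H1 H2). Qed.

Lemma csum_unique (u : nat -> C) (l : C) : summable u -> is_cseries u l -> csum u = l.
Proof. intros Hu Hl. apply (is_cseries_unique u); [apply csum_correct|]; assumption. Qed.

Lemma summable_le (u : nat -> C) (b : nat -> R) :
  (forall n, Cmod (u n) <= b n) -> ex_series b -> summable u.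
Proof.
  intros H Hb. unfold summable. apply ex_series_le_R with (2 := Hb).
  intros n.
  rewrite Rabs_pos_eq; [apply H|apply Cmod_ge_0].
Qed.

Lemma csum_ext (u v : nat -> C) : (forall n, u n = v n) -> csum u = csum v.
Proof. intros H. unfold csum. f_equal; apply Series_ext; intros n; now rewrite H. Qed.

Lemma summable_plus (u v : nat -> C) : summable u -> summable v ->
  summable (fun n => u n + v n)%C.
Proof.
  intros Hu Hv. apply summable_le with (b := fun n => Cmod (u n) + Cmod (v n)).
  - intros n. apply Cmod_triangle.
  - exact (ex_series_plus _ _ Hu Hv).
Qed.

Lemma summable_scal (k : C) (u : nat -> C) : summable u -> summable (fun n => k * u n)%C.
Proof.
  intros Hu. apply summable_le with (b := fun n => Cmod k * Cmod (u n)).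
  - intros n. rewrite Cmod_mult. lra.
  - exact (ex_series_scal (Cmod k) _ Hu).
Qed.

Lemma csum_plus (u v : nat -> C) : summable u -> summable v ->
  csum (fun n => u n + v n)%C = (csum u + csum v)%C.
Proof.
  intros Hu Hv. apply csum_unique.
  - now apply summable_plus.
  - exact (is_series_plus _ _ _ _ (csum_correct _ Hu) (csum_correct _ Hv)).
Qed.

Lemma csum_scal (k : C) (u : nat -> C) : summable u ->
  csum (fun n => k * u n)%C = (k * csum u)%C.
Proof.
  intros Hu. apply csum_unique.
  - now apply summable_scal.
  - exact (is_series_scal k _ _ (csum_correct _ Hu)).
Qed.

Lemma csum_incr_1 (u : nat -> C) : summable u ->
  csum u = (u 0%nat + csum (fun n => u (S n)))%C.
Proof.
  intros Hu.
  assert (Hr : ex_series (fun n => Re (u n))).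
  { apply ex_series_le_R with (2 := Hu). intros n. apply re_le_Cmod. }
  assert (Hi : ex_series (fun n => Im (u n))).
  { apply ex_series_le_R with (2 := Hu). intros n. apply im_le_Cmod. }
  unfold csum. rewrite (Series_incr_1 _ Hr), (Series_incr_1 _ Hi). reflexivity.
Qed.

Lemma Cmod_csum_le (u : nat -> C) (b : nat -> R) :
  (forall n, Cmod (u n) <= b n) -> ex_series b -> Cmod (csum u) <= Series b.
Proof.
  intros H Hb. pose proof (csum_correct u (summable_le u b H Hb)) as Hs.
  assert (Hn : is_lim_seq (fun n => Cmod (sum_n (G := C_NormedModule) u n)) (Cmod (csum u))).
  { exact (filterlim_comp _ _ _ _ _ _ _ _ Hs (filterlim_norm (V := C_NormedModule) (csum u))). }
  assert (Hl : is_lim_seq (sum_n b) (Series b)) by exact (Series_correct _ Hb).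
  refine (is_lim_seq_le _ _ (Cmod (csum u)) (Series b) _ Hn Hl).
  intros n. induction n as [|n IH].
  - rewrite !sum_O. apply H.
  - rewrite !sum_Sn. apply Rle_trans with (1 := Cmod_triangle _ _).
    apply Rplus_le_compat; [exact IH|apply H].
Qed.

Lemma pow_n_Cpow (z : C) (n : nat) : pow_n (K := C_Ring) z n = (z ^ n)%C.
Proof. induction n as [|n IH]; simpl; [reflexivity|]. now rewrite IH. Qed.

Lemma Cmod_pow_le_1 (z : C) (n : nat) : Cmod z <= 1 -> Cmod (z ^ n)%C <= 1.
Proof.
  intros H. rewrite Cmod_pow. rewrite <- (pow1 n). apply pow_incr.
  split; [apply Cmod_ge_0|exact H].
Qed.

(** * Complex differentiability from quadratic remainder estimates *)

Lemma is_derive_C_quadratic (f : C -> C) (z l : C) (K d : R) : 0 < d ->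
  (forall w, Cmod (w - z)%C < d ->
     Cmod (f w - f z - (w - z) * l)%C <= K * (Cmod (w - z)%C * Cmod (w - z)%C)) ->
  is_derive (K := C_AbsRing) (V := C_NormedModule) f z l.
Proof.
  intros Hd H. split.
  - apply is_linear_scal_l.
  - intros x Hx eps.
    assert (Ex : z = x).
    { exact (is_filter_lim_locally_unique (V := AbsRing_NormedModule C_AbsRing) z x Hx). }
    subst x.
    (* On this radius [K * |w - z| <= eps]; the [+ 1] keeps the quotient defined when [K = 0]. *)
    assert (Hp : 0 < Rmin d (eps / (Rabs K + 1))).
    { apply Rmin_pos; [exact Hd|]. apply Rdiv_lt_0_compat; [apply eps|].
      generalize (Rabs_pos K). lra. }
    exists (mkposreal _ Hp). intros w Hw.
    change (Cmod (f w - f z - (w - z) * l)%C <= eps * Cmod (w - z)%C).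
    change (Cmod (w - z)%C < Rmin d (eps / (Rabs K + 1))) in Hw.
    assert (H1 := Rlt_le_trans _ _ _ Hw (Rmin_l _ _)).
    assert (H2 := Rlt_le_trans _ _ _ Hw (Rmin_r _ _)).
    apply Rle_trans with (1 := H w H1). rewrite <- Rmult_assoc.
    apply Rmult_le_compat_r; [apply Cmod_ge_0|].
    generalize (Rabs_pos K) (Rle_abs K) (Cmod_ge_0 (w - z)%C). intros K0 K1 K2.
    apply Rlt_div_r in H2; [|lra]. nra.
Qed.

Lemma Cmod_pow_sub_le (z w : C) (r : R) (n : nat) : Cmod z <= r -> Cmod w <= r ->
  Cmod (w ^ (S n) - z ^ (S n))%C <= INR (S n) * r ^ n * Cmod (w - z)%C.
Proof.
  intros Hz Hw.
  assert (Hr : 0 <= r) by (generalize (Cmod_ge_0 z); lra).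
  induction n as [|n IH].
  - rewrite !Cpow_S. simpl. rewrite !Cmult_1_r. lra.
  - replace (w ^ S (S n) - z ^ S (S n))%C
      with (w * (w ^ S n - z ^ S n) + z ^ S n * (w - z))%C by (rewrite !(Cpow_S _ (S n)); ring).
    apply Rle_trans with (1 := Cmod_triangle _ _). rewrite !Cmod_mult.
    assert (Hp : Cmod (z ^ S n)%C <= r ^ S n).
    { rewrite Cmod_pow. apply pow_incr. split; [apply Cmod_ge_0|exact Hz]. }
    rewrite (S_INR (S n)).
    apply Rle_trans with (r * (INR (S n) * r ^ n * Cmod (w - z)) + r ^ S n * Cmod (w - z)).
    + apply Rplus_le_compat.
      * apply Rmult_le_compat; try apply Cmod_ge_0; assumption.
      * apply Rmult_le_compat_r; [apply Cmod_ge_0|exact Hp].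
    + right. simpl pow. ring.
Qed.

(** The constant grows only linearly in [n], at the price of [1 / (1 - r)], so that summability of
    [n |a_n|] is enough to differentiate termwise. The induction closes because
    [r N / (1 - r) + N = N / (1 - r)]. *)
Lemma Cmod_pow_remainder_le (z w : C) (r : R) (n : nat) :
  r < 1 -> Cmod z <= r -> Cmod w <= r ->
  Cmod (w ^ (S n) - z ^ (S n) - (w - z) * (INR (S n) * z ^ n))%C
    <= INR (S n) / (1 - r) * (Cmod (w - z)%C * Cmod (w - z)%C).
Proof.
  intros Hr1 Hz Hw.
  assert (Hr : 0 <= r) by (generalize (Cmod_ge_0 z); lra).
  assert (Hq : 0 <= Cmod (w - z)%C * Cmod (w - z)%C).
  { apply Rmult_le_pos; apply Cmod_ge_0. }
  assert (Hi : 0 < / (1 - r)) by (apply Rinv_0_lt_compat; lra).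
  induction n as [|n IH].
  - replace (w ^ 1 - z ^ 1 - (w - z) * (INR 1 * z ^ 0))%C with (RtoC 0) by (simpl; ring).
    rewrite Cmod_0. simpl. unfold Rdiv. nra.
  - replace (w ^ S (S n) - z ^ S (S n) - (w - z) * (INR (S (S n)) * z ^ S n))%C
      with (w * (w ^ S n - z ^ S n - (w - z) * (INR (S n) * z ^ n))
            + INR (S n) * z ^ n * ((w - z) * (w - z)))%C.
    2:{ rewrite (S_INR (S n)), RtoC_plus, !(Cpow_S _ (S n)), (Cpow_S z n). ring. }
    apply Rle_trans with (1 := Cmod_triangle _ _).
    rewrite !Cmod_mult, Cmod_R, (Rabs_pos_eq _ (pos_INR _)).
    assert (Hp : Cmod (z ^ n)%C <= 1) by (apply Cmod_pow_le_1; lra).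
    rewrite (S_INR (S n)). assert (HN := pos_INR (S n)).
    set (q := Cmod (w - z)%C * Cmod (w - z)%C) in *. set (N := INR (S n)) in *.
    apply Rle_trans with (r * (N / (1 - r) * q) + N * 1 * q).
    + apply Rplus_le_compat.
      * apply Rmult_le_compat; try apply Cmod_ge_0; assumption.
      * apply Rmult_le_compat_r; [exact Hq|]. apply Rmult_le_compat_l; assumption.
    + apply Rle_trans with (N / (1 - r) * q).
      * right. field. lra.
      * apply Rmult_le_compat_r; [exact Hq|]. apply Rmult_le_compat_r; lra.
Qed.

(** * Complex power series *)

Definition PS (a : nat -> C) (z : C) : C := csum (fun n => a n * z ^ n)%C.

Definition Cderiv_coef (a : nat -> C) (n : nat) : C := (INR (S n) * a (S n))%C.

Lemma summable_PS (a : nat -> C) (z : C) : summable a -> Cmod z <= 1 ->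
  summable (fun n => a n * z ^ n)%C.
Proof.
  intros Ha Hz. apply summable_le with (2 := Ha). intros n.
  rewrite Cmod_mult. generalize (Cmod_pow_le_1 z n Hz) (Cmod_ge_0 (a n)). nra.
Qed.

Lemma is_pseries_PS (a : nat -> C) (z : C) : summable a -> Cmod z < 1 ->
  is_pseries (K := C_AbsRing) (V := C_NormedModule) a z (PS a z).
Proof.
  intros Ha Hz. unfold is_pseries.
  apply is_series_ext with (a := fun n => (a n * z ^ n)%C).
  - intros n. transitivity (pow_n (K := C_Ring) z n * a n)%C; [|reflexivity].
    rewrite (pow_n_Cpow z n : pow_n (K := C_Ring) z n = (z ^ n)%C). apply Cmult_comm.
  - apply csum_correct, summable_PS; [exact Ha|]. lra.
Qed.

Lemma summable_of_Cderiv_coef (a : nat -> C) : summable (Cderiv_coef a) -> summable a.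
Proof.
  intros H. unfold summable. apply ex_series_incr_1.
  apply ex_series_le_R with (2 := H). intros n.
  rewrite (Rabs_pos_eq _ (Cmod_ge_0 _)). unfold Cderiv_coef.
  rewrite Cmod_mult, Cmod_R, (Rabs_pos_eq _ (pos_INR _)).
  generalize (Cmod_ge_0 (a (S n))) (pos_INR n). rewrite S_INR. nra.
Qed.

Lemma is_derive_PS (a : nat -> C) (z : C) : summable (Cderiv_coef a) -> Cmod z < 1 ->
  is_derive (K := C_AbsRing) (V := C_NormedModule) (PS a) z (PS (Cderiv_coef a) z).
Proof.
  intros Hd Hz. assert (Ha := summable_of_Cderiv_coef a Hd).
  set (r := (1 + Cmod z) / 2).
  assert (Hr : Cmod z < r < 1) by (unfold r; lra).
  apply is_derive_C_quadratic with (d := r - Cmod z)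
    (K := Series (fun n => / (1 - r) * Cmod (Cderiv_coef a n))); [lra|].
  intros w Hw.
  assert (Hwr : Cmod w <= r).
  { replace w with (z + (w - z))%C by ring. apply Rle_trans with (1 := Cmod_triangle _ _). lra. }
  assert (Sz := summable_PS a z Ha ltac:(lra)). assert (Sw := summable_PS a w Ha ltac:(lra)).
  assert (Sd := summable_PS _ z Hd ltac:(lra)).
  assert (Sz1 : summable (fun n => a (S n) * z ^ S n)%C) by exact (proj1 (ex_series_incr_1 _) Sz).
  assert (Sw1 : summable (fun n => a (S n) * w ^ S n)%C) by exact (proj1 (ex_series_incr_1 _) Sw).
  assert (Sz2 : summable (fun n => -(1) * (a (S n) * z ^ S n))%C).
  { now apply summable_scal. }
  assert (Sd2 : summable (fun n => -(w - z) * (Cderiv_coef a n * z ^ n))%C).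
  { now apply summable_scal. }
  (* The constant terms cancel, so the whole remainder is one series indexed from exponent 1, to be
     bounded term by term. *)
  assert (E : (PS a w - PS a z - (w - z) * PS (Cderiv_coef a) z)%C =
    csum (fun n => a (S n) * w ^ S n + -(1) * (a (S n) * z ^ S n)
             + -(w - z) * (Cderiv_coef a n * z ^ n))%C).
  { unfold PS. rewrite csum_plus, csum_plus, !csum_scal; try assumption.
    - rewrite (csum_incr_1 _ Sz), (csum_incr_1 _ Sw). simpl. ring.
    - now apply summable_plus. }
  rewrite E, <- Series_scal_r.
  apply Cmod_csum_le.
  - intros n.
    replace (a (S n) * w ^ S n + - (1) * (a (S n) * z ^ S n)
             + - (w - z) * (Cderiv_coef a n * z ^ n))%C
      with (a (S n) * (w ^ S n - z ^ S n - (w - z) * (INR (S n) * z ^ n)))%C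
      by (unfold Cderiv_coef; ring).
    unfold Cderiv_coef.
    rewrite !Cmod_mult, Cmod_R, (Rabs_pos_eq _ (pos_INR _)).
    apply Rle_trans with (Cmod (a (S n)) *
      (INR (S n) / (1 - r) * (Cmod (w - z)%C * Cmod (w - z)%C))).
    + apply Rmult_le_compat_l; [apply Cmod_ge_0|].
      apply Cmod_pow_remainder_le; lra.
    + right. unfold Rdiv. ring.
  - apply ex_series_scal_r. exact (ex_series_scal (/ (1 - r)) _ Hd).
Qed.

(** * Fixed points of contractions on a closed disc *)

Lemma is_lim_seq_ge_const (u : nat -> R) (k l : R) :
  (forall n, k <= u n) -> is_lim_seq u l -> k <= l.
Proof.
  intros H Hu. exact (is_lim_seq_le (fun _ => k) u k l H (is_lim_seq_const k) Hu).
Qed.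

(** Banach's theorem. The limit is built as [c] plus the series of increments of the iteration,
    which a geometric series dominates, so completeness enters only through [csum_correct]. *)
Lemma contraction_fixpoint (phi : C -> C) (c : C) (d q : R) : 0 <= q < 1 -> 0 <= d ->
  (forall u, Cmod (u - c)%C <= d -> Cmod (phi u - c)%C <= d) ->
  (forall u v, Cmod (u - c)%C <= d -> Cmod (v - c)%C <= d ->
     Cmod (phi u - phi v)%C <= q * Cmod (u - v)%C) ->
  exists u, Cmod (u - c)%C <= d /\ phi u = u.
Proof.
  intros Hq Hd Hmap Hcon.
  set (x := fix x n := match n with O => c | S n => phi (x n) end).
  assert (x0 : x 0%nat = c) by reflexivity.
  assert (xS : forall n, x (S n) = phi (x n)) by reflexivity.
  clearbody x.
  assert (Hx : forall n, Cmod (x n - c)%C <= d).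
  { induction n as [|n IH]; [rewrite x0|rewrite xS; now apply Hmap].
    replace (c - c)%C with (RtoC 0) by ring. now rewrite Cmod_0. }
  set (D := fun n => (x (S n) - x n)%C).
  assert (HD : forall n, Cmod (D n) <= q ^ n * Cmod (D 0%nat)).
  { induction n as [|n IH]; [simpl pow; lra|].
    apply Rle_trans with (q * Cmod (D n)); [|simpl pow; nra].
    unfold D.
    replace (x (S (S n)) - x (S n))%C with (phi (x (S n)) - phi (x n))%C by now rewrite !xS.
    apply Hcon; apply Hx. }
  assert (SD : summable D).
  { apply summable_le with (1 := HD). apply ex_series_scal_r, ex_series_geom.
    rewrite Rabs_pos_eq; lra. }
  assert (Hsum : forall n, sum_n (G := C_NormedModule) D n = (x (S n) - c)%C).
  { induction n as [|n IH].
    - rewrite sum_O. unfold D. now rewrite x0.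
    - rewrite sum_Sn, IH. unfold D.
      change ((x (S n) - c) + (x (S (S n)) - x (S n)) = x (S (S n)) - c)%C. ring. }
  set (l := (c + csum D)%C).
  assert (Hl : is_lim_seq (fun n => Cmod (x (S n) - l)%C) 0).
  { assert (H := csum_correct D SD).
    apply is_lim_seq_spec. intros eps. simpl.
    destruct (proj1 (filterlim_locally_ball_norm _ _) H eps) as [N HN].
    exists N. intros n Hn. specialize (HN n Hn). unfold ball_norm in HN.
    rewrite Hsum in HN. rewrite Rminus_0_r, Rabs_pos_eq by apply Cmod_ge_0.
    change (Cmod (x (S n) - c - csum D)%C < eps) in HN.
    replace (x (S n) - l)%C with (x (S n) - c - csum D)%C by (unfold l; ring). exact HN. }
  assert (Hlc : Cmod (l - c)%C <= d).
  { replace d with (0 + d) by ring.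
    apply is_lim_seq_ge_const with (u := fun n => Cmod (x (S n) - l)%C + d).
    - intros n. replace (l - c)%C with (- (x (S n) - l) + (x (S n) - c))%C by ring.
      apply Rle_trans with (1 := Cmod_triangle _ _). rewrite Cmod_opp.
      apply Rplus_le_compat_l, Hx.
    - apply is_lim_seq_plus' with (1 := Hl), is_lim_seq_const. }
  exists l. split; [exact Hlc|].
  assert (H0 : Cmod (phi l - l)%C <= 0).
  { replace 0 with (q * 0 + 0) by ring.
    apply is_lim_seq_ge_const
      with (u := fun n => q * Cmod (x (S n) - l)%C + Cmod (x (S (S n)) - l)%C).
    - intros n. replace (phi l - l)%C with ((phi l - x (S (S n))) + (x (S (S n)) - l))%C by ring.
      apply Rle_trans with (1 := Cmod_triangle _ _). apply Rplus_le_compat_r.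
      replace (Cmod (x (S n) - l)%C) with (Cmod (l - x (S n))%C)
        by (rewrite <- Cmod_opp; f_equal; ring).
      rewrite (xS (S n)). apply Hcon; [exact Hlc|apply Hx].
    - apply is_lim_seq_plus'.
      + exact (is_lim_seq_scal_l _ q 0 Hl).
      + exact (proj1 (is_lim_seq_incr_1 _ _) Hl). }
  assert (H1 : (phi l - l)%C = 0).
  { apply Cmod_eq_0. generalize (Cmod_ge_0 (phi l - l)%C). lra. }
  replace (phi l) with ((phi l - l) + l)%C by ring. rewrite H1. ring.
Qed.
Lemma csum_minus (u v : nat -> C) : summable u -> summable v ->
  csum (fun n => u n - v n)%C = (csum u - csum v)%C.
Proof.
  intros Hu Hv.
  rewrite (csum_ext _ (fun n => u n + - (1) * v n)%C) by (intros n; ring).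
  rewrite csum_plus, csum_scal; [ring|..]; try assumption. now apply summable_scal.
Qed.

Definition shift_coef (a : nat -> C) (n : nat) : C :=
  match n with O => RtoC 0 | S m => a m end.

Lemma summable_shift_coef (a : nat -> C) : summable a -> summable (shift_coef a).
Proof. intros Ha. unfold summable. apply ex_series_incr_1. exact Ha. Qed.

Lemma PS_shift_coef (a : nat -> C) (z : C) : summable a -> Cmod z <= 1 ->
  PS (shift_coef a) z = (z * PS a z)%C.
Proof.
  intros Ha Hz. unfold PS.
  rewrite csum_incr_1 by now apply (summable_PS _ _ (summable_shift_coef a Ha)).
  rewrite <- csum_scal by now apply summable_PS.
  simpl. rewrite Cmult_0_l, Cplus_0_l. apply csum_ext. intros n. ring.
Qed.

(** * A coefficient condition for the class S_p *)

Section Small_coefficients.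

Variable g : nat -> C.
Hypothesis g0 : g 0%nat = RtoC 1.
(** The weight is [2 m + 1] at [m = n + 1]: the constant term of [g] is left out. *)
Let W (n : nat) : R := (2 * INR n + 3) * Cmod (g (S n)).
Hypothesis W_ex : ex_series W.
Hypothesis W_le : Series W <= 1.

Let W_bound (k : R) (n : nat) : 0 <= k <= 2 * INR n + 3 -> 0 <= k * Cmod (g (S n)) <= W n.
Proof. intros Hk. unfold W. generalize (Cmod_ge_0 (g (S n))). nra. Qed.

Let sub_ex (k : nat -> R) : (forall n, 0 <= k n <= 2 * INR n + 3) ->
  ex_series (fun n => k n * Cmod (g (S n))).
Proof.
  intros Hk. apply ex_series_le_R with (2 := W_ex). intros n.
  assert (H := W_bound _ _ (Hk n)). rewrite Rabs_pos_eq; lra.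
Qed.

Let sub_le (k : nat -> R) : (forall n, 0 <= k n <= 2 * INR n + 3) ->
  Series (fun n => k n * Cmod (g (S n))) <= 1.
Proof.
  intros Hk. apply Rle_trans with (2 := W_le). apply Series_le with (2 := W_ex).
  intros n. apply W_bound, Hk.
Qed.

Lemma small_coef_deriv_summable : summable (Cderiv_coef g).
Proof.
  apply summable_le with (b := fun n => (INR n + 1) * Cmod (g (S n))).
  - intros n. unfold Cderiv_coef. rewrite Cmod_mult, Cmod_R, (Rabs_pos_eq _ (pos_INR _)), S_INR.
    lra.
  - apply sub_ex. intros n. generalize (pos_INR n). lra.
Qed.

Lemma small_coef_summable : summable g.
Proof. apply summable_of_Cderiv_coef, small_coef_deriv_summable. Qed.

Lemma small_coef_tail_summable (z : C) (k : nat) : Cmod z <= 1 ->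
  summable (fun n => g (S n) * z ^ (k + n))%C.
Proof.
  intros Hz. apply summable_le with (b := fun n => 1 * Cmod (g (S n))).
  - intros n. rewrite Cmod_mult.
    generalize (Cmod_pow_le_1 z (k + n) Hz) (Cmod_ge_0 (g (S n))). nra.
  - apply sub_ex. intros n. generalize (pos_INR n). lra.
Qed.

Let F (z : C) : C := (z * PS g z)%C.
Let H (z : C) : C := csum (fun n => g (S n) * z ^ (2 + n))%C.

Lemma small_coef_decomp (z : C) : Cmod z <= 1 -> F z = (z + H z)%C.
Proof.
  intros Hz. unfold F, PS. rewrite csum_incr_1 by now apply summable_PS, Hz; apply small_coef_summable.
  rewrite g0. unfold H.
  rewrite (csum_ext (fun n => g (S n) * z ^ (2 + n))%C
    (fun n => z * (g (S n) * z ^ (1 + n)))%C) by (intros n; simpl; ring).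
  rewrite csum_scal by now apply small_coef_tail_summable. simpl. ring.
Qed.

(** The factor [r] comes from [r ^ (n + 1) <= r], and the remaining sum of [(n + 2) |g (n + 1)|] is
    at most 1. Having [r] rather than 1 gives injectivity of [z + H z] on each smaller disc even
    when the coefficient sum is exactly 1. *)
Lemma small_coef_tail_lipschitz (z w : C) (r : R) : Cmod z <= r -> Cmod w <= r -> r <= 1 ->
  Cmod (H z - H w)%C <= r * Cmod (z - w)%C.
Proof.
  intros Hz Hw Hr. assert (Hr0 := Cmod_ge_0 z). unfold H.
  rewrite <- csum_minus by (apply small_coef_tail_summable; lra).
  apply Rle_trans with (Series (fun n => (r * Cmod (z - w)) * ((INR n + 2) * Cmod (g (S n))))).
  - apply Cmod_csum_le.
    + intros n. replace (g (S n) * z ^ (2 + n) - g (S n) * w ^ (2 + n))%C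
        with (g (S n) * (z ^ (S (S n)) - w ^ (S (S n))))%C by (simpl; ring).
      rewrite Cmod_mult.
      assert (H1 := Cmod_pow_sub_le w z r (S n) Hw Hz).
      assert (H2 : r ^ S n <= r).
      { simpl. assert (r ^ n <= 1) by (rewrite <- (pow1 n); apply pow_incr; lra). nra. }
      rewrite !S_INR in H1. assert (H3 := pos_INR n). assert (H4 := Cmod_ge_0 (z - w)%C).
      assert (H5 : (INR n + 1 + 1) * r ^ S n * Cmod (z - w) <= (INR n + 2) * (r * Cmod (z - w))).
      { assert (r ^ S n * Cmod (z - w) <= r * Cmod (z - w)) by (apply Rmult_le_compat_r; lra). nra. }
      generalize (Cmod_ge_0 (g (S n))). nra.
    + apply (ex_series_scal (V := R_NormedModule) (r * Cmod (z - w))), sub_ex.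
      intros n. generalize (pos_INR n). lra.
  - rewrite Series_scal_l. assert (H4 := Cmod_ge_0 (z - w)%C).
    assert (Hs : Series (fun n => (INR n + 2) * Cmod (g (S n))) <= 1).
    { apply sub_le. intros n. generalize (pos_INR n). lra. }
    assert (0 <= r * Cmod (z - w)) by (apply Rmult_le_pos; lra). nra.
Qed.

Lemma small_coef_univalent (z w : C) : Cmod z < 1 -> Cmod w < 1 -> F z = F w -> z = w.
Proof.
  intros Hz Hw E. rewrite !small_coef_decomp in E by lra.
  set (r := Rmax (Cmod z) (Cmod w)).
  assert (Hr : r < 1) by (apply Rmax_lub_lt; assumption).
  assert (L := small_coef_tail_lipschitz w z r (Rmax_r _ _) (Rmax_l _ _) ltac:(lra)).
  replace (H w - H z)%C with (z - w)%C in L.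
  2:{ replace (z - w)%C with ((z + H z) - H z - w)%C by ring. rewrite E. ring. }
  replace (Cmod (w - z)%C) with (Cmod (z - w)%C) in L
    by (rewrite <- Cmod_opp; f_equal; ring).
  assert (H0 : Cmod (z - w)%C = 0).
  { generalize (Cmod_ge_0 (z - w)%C). nra. }
  apply Cmod_eq_0 in H0. replace z with ((z - w) + w)%C by ring. rewrite H0. ring.
Qed.

(** Bernoulli's inequality. It measures [s - u ^ (n + 2)] at the centre [u = s] in units of the
    radius [1 - s] of the disc used for starlikeness. *)
Lemma pow_deficit_le (s : R) (n : nat) : 0 <= s <= 1 ->
  0 <= s - s ^ (2 + n) <= (INR n + 1) * (1 - s).
Proof.
  intros Hs.
  assert (Hn : 0 <= 1 - s ^ S n <= (INR n + 1) * (1 - s)).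
  { induction n as [|n IH]; [simpl; lra|].
    rewrite S_INR. change (s ^ S (S n)) with (s * s ^ S n). nra. }
  change (s ^ (2 + n)) with (s * s ^ S n). nra.
Qed.

(* Writing w = z u, the equation F w = s F z says that u is a fixed point of
   u |-> s + sum_n b_n (s - u^n); the disc of centre s and radius 1 - s lies in
   the closed unit disc and is mapped into itself exactly because
   sum_n (2 n - 1) |b_n| <= 1. *)
Lemma small_coef_starlike (z : C) (s : R) : Cmod z < 1 -> 0 <= s <= 1 ->
  exists w, Cmod w < 1 /\ F w = (s * F z)%C.
Proof.
  intros Hz Hs. assert (Hz0 := Cmod_ge_0 z).
  set (b := fun n => (g (S n) * z ^ (1 + n))%C).
  assert (Sb : summable b) by (apply small_coef_tail_summable; lra).
  assert (Hb : forall n, Cmod (b n) <= Cmod z * Cmod (g (S n))).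
  { intros n. unfold b. rewrite Cmod_mult, Cpow_add_r, Cpow_1_r, Cmod_mult.
    generalize (Cmod_pow_le_1 z n ltac:(lra)) (Cmod_ge_0 (g (S n))) (Cmod_ge_0 (z ^ n)%C).
    intros P1 P2 P3. assert (Cmod z * Cmod (z ^ n)%C <= Cmod z) by nra. nra. }
  assert (Sbu : forall u, Cmod u <= 1 -> summable (fun n => b n * u ^ (2 + n))%C).
  { intros u Hu. apply summable_le with (2 := Sb). intros n. rewrite Cmod_mult.
    generalize (Cmod_pow_le_1 u (2 + n) Hu) (Cmod_ge_0 (b n)). nra. }
  set (phi := fun u => (s + csum (fun n => b n * (s - u ^ (2 + n))))%C).
  assert (Sphi : forall u, Cmod u <= 1 -> summable (fun n => b n * (s - u ^ (2 + n)))%C).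
  { intros u Hu. apply summable_le with
      (b := fun n => Cmod (s * b n + - (1) * (b n * u ^ (2 + n)))%C).
    - intros n. right. f_equal. ring.
    - apply summable_plus; apply summable_scal; auto. }
  assert (Hball : forall u, Cmod (u - s)%C <= 1 - s -> Cmod u <= 1).
  { intros u Hu. replace u with ((u - s) + s)%C by ring.
    apply Rle_trans with (1 := Cmod_triangle _ _). rewrite Cmod_R, Rabs_pos_eq; lra. }
  (* The contraction factor is [|z|]: each [b n] contains a positive power of [z], and the sum of
     [(n + 2) |g (n + 1)|] is at most 1. *)
  destruct (contraction_fixpoint phi s (1 - s) (Cmod z)) as [u [Hu Eu]]; [lra|lra|..].
  - intros u Hu. unfold phi.
    replace (s + csum (fun n => b n * (s - u ^ (2 + n))) - s)%C
      with (csum (fun n => b n * (s - u ^ (2 + n)))%C) by ring.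
    apply Rle_trans with (Series (fun n => (1 - s) * W n)).
    + apply Cmod_csum_le; [|exact (ex_series_scal (1 - s) _ W_ex)].
      intros n. rewrite Cmod_mult.
      replace (s - u ^ (2 + n))%C with ((s - s ^ (2 + n))%R + (s ^ (2 + n) - u ^ (2 + n)))%C
        by (rewrite RtoC_minus, RtoC_pow; ring).
      assert (P1 := pow_deficit_le s n Hs).
      assert (P2 := Cmod_pow_sub_le u s 1 (S n) (Hball u Hu)
        ltac:(rewrite Cmod_R, Rabs_pos_eq; lra)).
      rewrite pow1, !S_INR in P2.
      replace (Cmod (s - u)%C) with (Cmod (u - s)%C) in P2
        by (rewrite <- Cmod_opp; f_equal; ring).
      assert (P3 := Cmod_triangle (s - s ^ (2 + n))%R (s ^ (2 + n) - u ^ (2 + n))%C).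
      rewrite Cmod_R, Rabs_pos_eq in P3 by lra.
      change (S (S n)) with (2 + n)%nat in P2.
      assert (P4 := pos_INR n).
      (* The deficit at the centre contributes [n + 1] and the distance from the centre [n + 2];
         together they give exactly the weight [2 n + 3] of [W]. *)
      assert (P5 : Cmod ((s - s ^ (2 + n))%R + (s ^ (2 + n) - u ^ (2 + n)))%C
        <= (2 * INR n + 3) * (1 - s)) by nra.
      assert (P6 := Hb n). assert (P7 := Cmod_ge_0 (g (S n))).
      assert (P8 : Cmod (b n) <= Cmod (g (S n))) by nra.
      apply Rle_trans with (Cmod (g (S n)) * ((2 * INR n + 3) * (1 - s))).
      * apply Rmult_le_compat; try apply Cmod_ge_0; assumption.
      * unfold W. right. ring.
    + rewrite Series_scal_l. nra.
  - intros u v Hu Hv. unfold phi.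
    replace (s + csum (fun n => b n * (s - u ^ (2 + n)))
      - (s + csum (fun n => b n * (s - v ^ (2 + n)))))%C
      with (csum (fun n => b n * (s - u ^ (2 + n))) - csum (fun n => b n * (s - v ^ (2 + n))))%C
      by ring.
    rewrite <- csum_minus by auto.
    apply Rle_trans with
      (Series (fun n => (Cmod z * Cmod (u - v)) * ((INR n + 2) * Cmod (g (S n))))).
    + apply Cmod_csum_le.
      * intros n. replace (b n * (s - u ^ (2 + n)) - b n * (s - v ^ (2 + n)))%C
          with (b n * (v ^ S (S n) - u ^ S (S n)))%C by (simpl; ring).
        assert (P := Cmod_pow_sub_le u v 1 (S n) (Hball u Hu) (Hball v Hv)).
        rewrite pow1, !S_INR in P.
        replace (Cmod (v - u)%C) with (Cmod (u - v)%C) in P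
          by (rewrite <- Cmod_opp; f_equal; ring).
        rewrite Cmod_mult.
        apply Rle_trans with (Cmod z * Cmod (g (S n)) * ((INR n + 1 + 1) * 1 * Cmod (u - v)%C)).
        -- apply Rmult_le_compat; try apply Cmod_ge_0; [apply Hb|exact P].
        -- right. ring.
      * apply (ex_series_scal (V := R_NormedModule) (Cmod z * Cmod (u - v)%C)), sub_ex.
        intros n. generalize (pos_INR n). lra.
    + rewrite Series_scal_l. assert (P := Cmod_ge_0 (u - v)%C).
      assert (Hs1 : Series (fun n => (INR n + 2) * Cmod (g (S n))) <= 1).
      { apply sub_le. intros n. generalize (pos_INR n). lra. }
      assert (0 <= Cmod z * Cmod (u - v)) by (apply Rmult_le_pos; lra). nra.
  - exists (z * u)%C.
    assert (Hu1 := Hball u Hu).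
    assert (Hzu : Cmod (z * u)%C < 1) by (rewrite Cmod_mult; nra).
    split; [exact Hzu|].
    rewrite !small_coef_decomp by lra. unfold H.
    rewrite (csum_ext (fun n => g (S n) * (z * u) ^ (2 + n))%C
      (fun n => z * (b n * u ^ (2 + n)))%C)
      by (intros n; unfold b; rewrite Cpow_mult_l; simpl; ring).
    rewrite (csum_ext (fun n => g (S n) * z ^ (2 + n))%C (fun n => z * b n)%C)
      by (intros n; unfold b; simpl; ring).
    rewrite !csum_scal by auto.
    unfold phi in Eu.
    rewrite (csum_ext _ (fun n => s * b n - b n * u ^ (2 + n))%C) in Eu by (intros n; ring).
    rewrite csum_minus, csum_scal in Eu; auto; [|now apply summable_scal].
    rewrite <- Eu at 1. ring.
Qed.

Lemma small_coef_value_ge (z : C) : Cmod z <= 1 ->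
  1 - Series (fun n => Cmod (g (S n))) <= Cmod (PS g z).
Proof.
  intros Hz. unfold PS. rewrite csum_incr_1 by (apply summable_PS; [apply small_coef_summable|exact Hz]).
  rewrite g0. set (t := csum _).
  assert (Ht : Cmod t <= Series (fun n => Cmod (g (S n)))).
  { apply Cmod_csum_le.
    - intros n. rewrite Cmod_mult.
      generalize (Cmod_pow_le_1 z (S n) Hz) (Cmod_ge_0 (g (S n))). nra.
    - exact (proj1 (ex_series_incr_1 _) small_coef_summable). }
  assert (H1 := Cmod_triangle (1 * z ^ 0 + t) (- t)).
  replace (1 * z ^ 0 + t + - t)%C with (RtoC 1) in H1 by (simpl; ring).
  rewrite Cmod_1, Cmod_opp in H1. lra.
Qed.

Lemma small_coef_deriv_le (z : C) : Cmod z <= 1 ->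
  Cmod (PS (Cderiv_coef g) z) <= Series (fun n => (INR n + 1) * Cmod (g (S n))).
Proof.
  intros Hz. apply Cmod_csum_le.
  - intros n. unfold Cderiv_coef.
    rewrite !Cmod_mult, Cmod_R, (Rabs_pos_eq _ (pos_INR _)), S_INR.
    generalize (Cmod_pow_le_1 z n Hz) (Cmod_ge_0 (g (S n))) (pos_INR n). intros P1 P2 P3.
    assert (0 <= (INR n + 1) * Cmod (g (S n))) by (apply Rmult_le_pos; lra). nra.
  - apply sub_ex. intros n. generalize (pos_INR n). lra.
Qed.

Lemma small_coef_UCV_quotient (z zeta : C) : Cmod z < 1 -> Cmod zeta < 1 ->
  0 < Cmod (PS g z) /\
  0 < Re (1 + (z - zeta) * PS (Cderiv_coef g) z / PS g z)%C.
Proof.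
  intros Hz Hzeta.
  assert (A0 := small_coef_value_ge z ltac:(lra)).
  assert (A1 := small_coef_deriv_le z ltac:(lra)).
  set (T0 := Series (fun n => Cmod (g (S n)))) in *.
  set (T1 := Series (fun n => (INR n + 1) * Cmod (g (S n)))) in *.
  assert (E1 : ex_series (fun n => (INR n + 1) * Cmod (g (S n)))).
  { apply sub_ex. intros n. generalize (pos_INR n). lra. }
  assert (E0 : ex_series (fun n => Cmod (g (S n)))).
  { exact (proj1 (ex_series_incr_1 _) small_coef_summable). }
  assert (HW : 2 * T1 + T0 <= 1).
  { apply Rle_trans with (2 := W_le). right. unfold T1, T0.
    rewrite <- Series_scal_l, <- Series_plus; [|exact (ex_series_scal 2 _ E1)|exact E0].
    apply Series_ext. intros n. unfold W. ring. }
  (* With [2 T1 + T0 <= 1] this gives [3 T0 <= 1], so [|g| >= 2/3]. *)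
  assert (H01 : T0 <= T1).
  { apply Series_le with (2 := E1). intros n.
    generalize (Cmod_ge_0 (g (S n))) (pos_INR n). nra. }
  assert (T0 <= 1 / 3) by lra.
  assert (Hg : 0 < Cmod (PS g z)) by lra.
  split; [exact Hg|].
  set (q := ((z - zeta) * PS (Cderiv_coef g) z / PS g z)%C).
  assert (Hq : Cmod q < 1).
  { unfold q. rewrite Cmod_div by (now apply Cmod_gt_0). rewrite Cmod_mult.
    apply Rlt_div_l; [exact Hg|].
    assert (D : Cmod (z - zeta)%C < 2).
    { apply Rle_lt_trans with (1 := Cmod_triangle _ _). rewrite Cmod_opp. lra. }
    assert (D0 := Cmod_ge_0 (z - zeta)%C). assert (D1 := Cmod_ge_0 (PS (Cderiv_coef g) z)).
    (* Strictness comes from [|z - zeta| < 2] when the derivative is nonzero, and from [|g| > 0]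
       when it vanishes. *)
    destruct (Rle_lt_or_eq_dec _ _ D1) as [P|P]; [nra|]. rewrite <- P. lra. }
  assert (R1 := re_le_Cmod q). apply Rabs_le_between in R1.
  change (Re (1 + q)) with (1 + Re q). lra.
Qed.

Theorem class_Sp_of_small_coef (G : C -> C) :
  (forall z, Cmod z < 1 -> G z = F z) -> class_Sp G.
Proof.
  intros HG. assert (Sg := small_coef_summable). assert (Sdg := small_coef_deriv_summable).
  (* The termwise primitive of [g]: its sum [f] has [f' = g], so [z f'] is [F]. *)
  set (fc := shift_coef (fun n => g n / INR (S n))%C).
  assert (Efc : forall n, Cderiv_coef fc n = g n).
  { intros n. unfold Cderiv_coef, fc, shift_coef. field.
    intros H0. apply (not_0_INR (S n)); [lia|]. now apply RtoC_inj. }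
  assert (Sfc1 : summable (Cderiv_coef fc)).
  { apply summable_le with (2 := Sg). intros n. rewrite Efc. lra. }
  assert (D1 : forall z, Cmod z < 1 ->
    is_derive (K := C_AbsRing) (V := C_NormedModule) (PS fc) z (PS g z)).
  { intros z Hz. replace (PS g z) with (PS (Cderiv_coef fc) z).
    - now apply is_derive_PS.
    - apply csum_ext. intros n. now rewrite Efc. }
  assert (D2 : forall z, Cmod z < 1 -> C_derive (PS fc) z = PS g z).
  { intros z Hz. apply is_C_derive_unique, D1, Hz. }
  assert (D3 : forall z, Cmod z < 1 -> C_derive (C_derive (PS fc)) z = PS (Cderiv_coef g) z).
  { intros z Hz. apply is_C_derive_unique.
    (* The first derivative is known to be [PS g] only inside the disc, so it is replaced on a
       neighbourhood of [z]. *)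
    apply is_derive_ext_loc with (f := PS g); [|now apply is_derive_PS].
    exists (mkposreal (1 - Cmod z) ltac:(lra)). intros w Hw.
    change (Cmod (w - z)%C < 1 - Cmod z) in Hw. symmetry. apply D2.
    replace w with (z + (w - z))%C by ring.
    apply Rle_lt_trans with (1 := Cmod_triangle _ _). lra. }
  repeat split.
  - exists (shift_coef g). repeat split; [exact g0|].
    intros z Hz. rewrite HG by exact Hz. unfold F. rewrite <- PS_shift_coef; auto.
    + apply is_pseries_PS; [now apply summable_shift_coef|exact Hz].
    + apply Rlt_le, Hz.
  - intros z w Hz Hw E. rewrite !HG in E by assumption.
    now apply small_coef_univalent.
  - intros z t Hz Ht. rewrite HG by exact Hz.
    destruct (small_coef_starlike z t Hz Ht) as [w [Hw Ew]].
    exists w. split; [exact Hw|]. now rewrite HG.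
  - exists (PS fc). split; [repeat split|].
    + exists fc. repeat split.
      * unfold fc, shift_coef. rewrite g0. simpl. field.
      * intros z Hz. apply is_pseries_PS; [|exact Hz].
        now apply summable_of_Cderiv_coef.
    + intros z Hz. rewrite D2 by exact Hz. apply Cmod_gt_0.
      apply (small_coef_UCV_quotient z z Hz Hz).
    + intros z zeta Hz Hzeta. rewrite D2, D3 by exact Hz.
      now apply small_coef_UCV_quotient.
    + intros z Hz. rewrite HG, D2 by exact Hz. reflexivity.
Qed.

End Small_coefficients.
(** * The Gauss series at 1 *)

Fixpoint rpoch (x : R) (n : nat) : R :=
  match n with
  | O => 1
  | S m => rpoch x m * (x + INR m)
  end.

Lemma rpoch_pos (x : R) (n : nat) : 0 < x -> 0 < rpoch x n.
Proof.
  intros Hx. induction n as [|n IH]; simpl; [lra|].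
  apply Rmult_lt_0_compat; [exact IH|]. generalize (pos_INR n). lra.
Qed.

Lemma rpoch_add (x : R) (n k : nat) : rpoch x (n + k) = rpoch x n * rpoch (x + INR n) k.
Proof.
  induction k as [|k IH]; [rewrite Nat.add_0_r; simpl; ring|].
  rewrite Nat.add_succ_r. simpl. rewrite IH, plus_INR. ring.
Qed.

Lemma rpoch_S_l (x : R) (n : nat) : rpoch x (S n) = x * rpoch (x + 1) n.
Proof. change (S n) with (1 + n)%nat. rewrite rpoch_add. simpl. ring. Qed.

Lemma rpoch_le (x y : R) (n : nat) : 0 < x <= y -> rpoch x n <= rpoch y n.
Proof.
  intros H. induction n as [|n IH]; simpl; [lra|].
  generalize (rpoch_pos x n ltac:(lra)) (pos_INR n). intros H1 H2.
  apply Rmult_le_compat; lra.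
Qed.

Definition gauss_term (a b c : R) (k : nat) : R :=
  rpoch a k * rpoch b k / (rpoch c k * INR (fact k)).

Lemma INR_fact_pos (n : nat) : 0 < INR (fact n).
Proof. apply lt_0_INR, lt_O_fact. Qed.

Lemma gauss_term_pos (a b c : R) (k : nat) : 0 < a -> 0 < b -> 0 < c ->
  0 < gauss_term a b c k.
Proof.
  intros Ha Hb Hc. apply Rdiv_lt_0_compat; apply Rmult_lt_0_compat;
    auto using rpoch_pos, INR_fact_pos.
Qed.

Lemma fact_S_INR (n : nat) : INR (fact (S n)) = (INR n + 1) * INR (fact n).
Proof. change (fact (S n)) with (S n * fact n)%nat. now rewrite mult_INR, S_INR. Qed.

Lemma gauss_term_S (a b c : R) (k : nat) : 0 < c ->
  gauss_term a b c (S k) =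
  gauss_term a b c k * ((a + INR k) * (b + INR k) / ((c + INR k) * (INR k + 1))).
Proof.
  intros Hc. unfold gauss_term. rewrite fact_S_INR. simpl.
  generalize (rpoch_pos c k Hc) (INR_fact_pos k) (pos_INR k). intros. field. lra.
Qed.

(** Since [(k + 1) t_(k+1) = t_k (a + k) (b + k) / (c + k)], the differences of [k t_k] are rational
    multiples of [t_k]. Convergence at 1, the limit of [k t_k] and both contiguous relations all
    rest on this. *)
Lemma gauss_term_telescope (a b c : R) (k : nat) : 0 < c ->
  INR (S k) * gauss_term a b c (S k) - INR k * gauss_term a b c k =
  - gauss_term a b c k * ((INR k * (c - a - b) - a * b) / (c + INR k)).
Proof.
  intros Hc. rewrite gauss_term_S, S_INR by exact Hc. generalize (pos_INR k). intros. field. lra.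
Qed.

(** The partial sums dominate [ln (n + 2)], by [ln (x + 1) - ln x <= 1 / x]. This serves to exclude
    a positive limit of [k t_k]. *)
Lemma harmonic_diverges : ~ ex_series (fun n => / INR (S n)).
Proof.
  intros [l Hl].
  assert (H : forall n, ln (INR n + 2) <= sum_n (fun n => / INR (S n)) n).
  { assert (Hln : forall x, 0 < x -> ln (x + 1) - ln x <= / x).
    { intros x Hx. rewrite <- ln_div by lra.
      replace ((x + 1) / x) with (1 + / x) by (field; lra).
      assert (0 < / x) by now apply Rinv_0_lt_compat.
      rewrite <- (ln_exp (/ x)) at 2. apply ln_le; [lra|].
      generalize (exp_ineq1_le (/ x)). lra. }
    induction n as [|n IH].
    - rewrite sum_O. simpl. generalize (Hln 1 ltac:(lra)). rewrite ln_1.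
      replace (0 + 2) with (1 + 1) by ring. lra.
    - rewrite sum_Sn. change plus with Rplus. generalize (Hln (INR n + 2) ltac:(generalize (pos_INR n); lra)).
      rewrite !S_INR. replace (INR n + 1 + 1) with (INR n + 2) by ring.
      replace (INR n + 1 + 2) with (INR n + 2 + 1) by ring. lra. }
  assert (Hb : forall n, ln (INR n + 2) <= l).
  { intros n. apply Rle_trans with (1 := H n).
    apply (is_lim_seq_incr_compare _ _ Hl). intros m. rewrite sum_Sn. change plus with Rplus.
    assert (0 < / INR (S (S m))) by (apply Rinv_0_lt_compat, lt_0_INR; lia). lra. }
  destruct (INR_unbounded (exp l)) as [n Hn].
  assert (Hl' : ln (exp l) < ln (INR n + 2)) by (apply ln_increasing; [apply exp_pos|lra]).
  rewrite ln_exp in Hl'. specialize (Hb n). lra.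
Qed.

Lemma sum_n_nonneg (u : nat -> R) (n : nat) : (forall k, 0 <= u k) -> 0 <= sum_n u n.
Proof.
  intros H. induction n as [|n IH]; [rewrite sum_O; apply H|].
  rewrite sum_Sn. change plus with Rplus. generalize (H (S n)). lra.
Qed.

Lemma ex_series_pos_bounded (u : nat -> R) (M : R) :
  (forall n, 0 <= u n) -> (forall n, sum_n u n <= M) -> ex_series u.
Proof.
  intros H0 HM. destruct (ex_finite_lim_seq_incr (sum_n u) M) as [l Hl].
  - intros n. rewrite sum_Sn. change plus with Rplus. generalize (H0 (S n)). lra.
  - exact HM.
  - exists l. exact Hl.
Qed.

(** Raabe's criterion: once the quotient in [gauss_term_telescope] exceeds half its limit
    [c - a - b], each term is bounded by a telescoping difference. *)
Lemma gauss_term_decrease (a b c : R) : 0 < a -> 0 < b -> a + b < c ->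
  exists K, forall k, (K <= k)%nat ->
    gauss_term a b c k <=
    2 / (c - a - b) * (INR k * gauss_term a b c k - INR (S k) * gauss_term a b c (S k)).
Proof.
  intros Ha Hb Hc. set (D := c - a - b). assert (HD : 0 < D) by (unfold D; lra).
  (* The threshold solves [k D - a b >= (D / 2) (c + k)] for [k]. *)
  destruct (INR_unbounded (2 / D * (a * b + c * D / 2))) as [K HK].
  exists K. intros k Hk. apply le_INR in Hk.
  assert (Ht := gauss_term_pos a b c k Ha Hb ltac:(lra)).
  assert (T := gauss_term_telescope a b c k ltac:(lra)). fold D in T.
  assert (Hq : D / 2 <= (INR k * D - a * b) / (c + INR k)).
  { generalize (pos_INR k); intros. apply -> Rle_div_r; [|lra].
    assert (2 / D * (a * b + c * D / 2) * (D / 2) <= INR k * (D / 2)) by (apply Rmult_le_compat_r; lra).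
    replace (2 / D * (a * b + c * D / 2) * (D / 2)) with (a * b + c * D / 2) in H0 by (field; lra).
    lra. }
  replace (INR k * gauss_term a b c k - INR (S k) * gauss_term a b c (S k))
    with (gauss_term a b c k * ((INR k * D - a * b) / (c + INR k))) by lra.
  apply Rle_trans with (2 / D * (gauss_term a b c k * (D / 2))).
  - right. field. lra.
  - apply Rmult_le_compat_l; [apply Rlt_le, Rdiv_lt_0_compat; lra|].
    apply Rmult_le_compat_l; lra.
Qed.

Lemma ex_series_gauss (a b c : R) : 0 < a -> 0 < b -> a + b < c ->
  ex_series (gauss_term a b c).
Proof.
  intros Ha Hb Hc. destruct (gauss_term_decrease a b c Ha Hb Hc) as [K HK].
  apply (ex_series_incr_n _ K). set (t := gauss_term a b c) in *.
  set (v := fun k => INR k * t k).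
  apply ex_series_pos_bounded with (M := 2 / (c - a - b) * v K).
  - intros n. apply Rlt_le, gauss_term_pos; lra.
  - assert (Hv : forall n, 0 <= v n).
    { intros n. apply Rmult_le_pos; [apply pos_INR|]. apply Rlt_le, gauss_term_pos; lra. }
    assert (H2 : 0 < 2 / (c - a - b)) by (apply Rdiv_lt_0_compat; lra).
    assert (H : forall n, sum_n (fun k => t (K + k)%nat) n <=
      2 / (c - a - b) * (v K - v (S (K + n)))).
    { induction n as [|n IH].
      - rewrite sum_O, Nat.add_0_r. apply HK. lia.
      - rewrite sum_Sn. change plus with Rplus. rewrite Nat.add_succ_r.
        specialize (HK (S (K + n)) ltac:(lia)). fold (v (S (K + n))) (v (S (S (K + n)))) in HK. lra. }
    intros n. specialize (H n). specialize (Hv (S (K + n))). nra.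
Qed.

(** Eventually [k t_k] decreases, so it has a limit [l >= 0]; if [l > 0], then [t_k >= l / k] and
    the convergence of the Gauss series would make the harmonic series converge. *)
Lemma gauss_term_lim (a b c : R) : 0 < a -> 0 < b -> a + b < c ->
  is_lim_seq (fun k => INR k * gauss_term a b c k) 0.
Proof.
  intros Ha Hb Hc. destruct (gauss_term_decrease a b c Ha Hb Hc) as [K HK].
  assert (Hex := ex_series_gauss a b c Ha Hb Hc).
  assert (Hp : forall k, 0 < gauss_term a b c k) by (intros; apply gauss_term_pos; lra).
  set (t := gauss_term a b c) in *. set (v := fun k => INR k * t k).
  apply (is_lim_seq_incr_n _ (S K)).
  assert (Hdec : forall n, v (S n + S K)%nat <= v (n + S K)%nat).
  { intros n. specialize (HK (n + S K)%nat ltac:(lia)).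
    fold (v (n + S K)%nat) (v (S (n + S K))) in HK.
    assert (H2 : 0 < 2 / (c - a - b)) by (apply Rdiv_lt_0_compat; lra).
    specialize (Hp (n + S K)%nat). change (S n + S K)%nat with (S (n + S K)).
    apply Rnot_lt_le. intros Hlt. nra. }
  destruct (ex_finite_lim_seq_decr (fun n => v (n + S K)%nat) 0) as [l Hl].
  - exact Hdec.
  - intros n. apply Rmult_le_pos; [apply pos_INR|apply Rlt_le, Hp].
  - assert (Hge : forall n, l <= v (n + S K)%nat) by exact (is_lim_seq_decr_compare _ _ Hl Hdec).
    assert (Hl0 : 0 <= l).
    { apply is_lim_seq_ge_const with (2 := Hl). intros n.
      apply Rmult_le_pos; [apply pos_INR|apply Rlt_le, Hp]. }
    destruct (Rle_lt_or_eq_dec _ _ Hl0) as [Hpos|<-]; [|exact Hl].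
    exfalso. apply harmonic_diverges.
    apply (ex_series_incr_n _ K).
    apply (ex_series_incr_n _ (S K)) in Hex.
    apply ex_series_le_R with (b := fun n => / l * t (S K + n)%nat);
      [|exact (ex_series_scal (/ l) _ Hex)].
    intros n. assert (HN : 0 < INR (S (K + n))) by (apply lt_0_INR; lia).
    rewrite Rabs_pos_eq by now apply Rlt_le, Rinv_0_lt_compat.
    specialize (Hge n). unfold v in Hge. replace (n + S K)%nat with (S (K + n)) in Hge by lia.
    change (S K + n)%nat with (S (K + n)).
    apply Rmult_le_reg_l with (INR (S (K + n)) * l); [now apply Rmult_lt_0_compat|].
    replace (INR (S (K + n)) * l * / INR (S (K + n))) with l by (field; lra).
    replace (INR (S (K + n)) * l * (/ l * t (S (K + n)))) with (INR (S (K + n)) * t (S (K + n)))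
      by (field; lra). exact Hge.
Qed.

(* The value at 1 of the Gauss series. *)
Definition gauss (a b c : R) : R := Series (gauss_term a b c).

(** Multiples of this series can be added to a Gauss series without changing its sum; each
    contiguous relation below picks the multiple that makes it hold term by term. *)
Lemma gauss_telescoping_series (a b c : R) : 0 < a -> 0 < b -> a + b < c ->
  is_series (fun k => INR (S k) * gauss_term a b c (S k) - INR k * gauss_term a b c k) 0.
Proof.
  intros Ha Hb Hc.
  change (is_lim_seq
    (sum_n (fun k => INR (S k) * gauss_term a b c (S k) - INR k * gauss_term a b c k)) 0).
  apply is_lim_seq_ext with (u := fun k => INR (S k) * gauss_term a b c (S k)).
  - intros n. symmetry. induction n as [|n IH].
    + rewrite sum_O. simpl. ring.
    + rewrite sum_Sn, IH. change plus with Rplus. ring.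
  - exact (proj1 (is_lim_seq_incr_1 _ _) (gauss_term_lim a b c Ha Hb Hc)).
Qed.

Lemma gauss_contiguous (a b c : R) : 0 < a -> 0 < b -> a + b < c ->
  (c - a) * gauss a (b + 1) (c + 1) = c * gauss a b c.
Proof.
  intros Ha Hb Hc.
  (* The multiple [c / b] makes the numerator factor as [(c - a) (b + n)]. *)
  assert (Hs := is_series_minus _ _ _ _
    (is_series_scal c _ _ (Series_correct _ (ex_series_gauss a b c Ha Hb Hc)))
    (is_series_scal (c / b) _ _ (gauss_telescoping_series a b c Ha Hb Hc))).
  assert (Hs' := is_series_scal (c - a) _ _
    (Series_correct _ (ex_series_gauss a (b + 1) (c + 1) Ha ltac:(lra) ltac:(lra)))).
  apply is_series_unique in Hs. apply is_series_unique in Hs'.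
  change (Series (fun n => (c - a) * gauss_term a (b + 1) (c + 1) n)
    = (c - a) * gauss a (b + 1) (c + 1)) in Hs'.
  change (Series (fun n => c * gauss_term a b c n - c / b *
    (INR (S n) * gauss_term a b c (S n) - INR n * gauss_term a b c n))
    = c * gauss a b c - c / b * 0) in Hs.
  rewrite <- Hs'. replace (c * gauss a b c) with (c * gauss a b c - c / b * 0) by ring.
  rewrite <- Hs. apply Series_ext. intros n.
  rewrite gauss_term_telescope by lra.
  assert (Hb1 : rpoch (b + 1) n = rpoch b n * (b + INR n) / b).
  { change (rpoch b n * (b + INR n)) with (rpoch b (S n)). rewrite rpoch_S_l. field. lra. }
  assert (Hc1 : rpoch (c + 1) n = rpoch c n * (c + INR n) / c).
  { change (rpoch c n * (c + INR n)) with (rpoch c (S n)). rewrite rpoch_S_l. field. lra. }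
  unfold gauss_term. rewrite Hb1, Hc1.
  generalize (rpoch_pos c n ltac:(lra)) (INR_fact_pos n) (pos_INR n). intros. field. lra.
Qed.

Lemma gauss_contiguous_c (a b c : R) : 0 < a -> 0 < b -> a + b < c ->
  (c - a) * (c - b) * gauss a b (c + 1) = c * (c - a - b) * gauss a b c.
Proof.
  intros Ha Hb Hc.
  (* The multiple [c] removes [n] from the numerator, leaving [(c - a) (c - b)]. *)
  assert (Hs := is_series_plus _ _ _ _
    (is_series_scal (c * (c - a - b)) _ _ (Series_correct _ (ex_series_gauss a b c Ha Hb Hc)))
    (is_series_scal c _ _ (gauss_telescoping_series a b c Ha Hb Hc))).
  assert (Hs' := is_series_scal ((c - a) * (c - b)) _ _
    (Series_correct _ (ex_series_gauss a b (c + 1) Ha ltac:(lra) ltac:(lra)))).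
  apply is_series_unique in Hs. apply is_series_unique in Hs'.
  change (Series (fun n => (c - a) * (c - b) * gauss_term a b (c + 1) n)
    = (c - a) * (c - b) * gauss a b (c + 1)) in Hs'.
  change (Series (fun n => c * (c - a - b) * gauss_term a b c n + c *
    (INR (S n) * gauss_term a b c (S n) - INR n * gauss_term a b c n))
    = c * (c - a - b) * gauss a b c + c * 0) in Hs.
  rewrite <- Hs'.
  replace (c * (c - a - b) * gauss a b c) with (c * (c - a - b) * gauss a b c + c * 0) by ring.
  rewrite <- Hs. apply Series_ext. intros n.
  rewrite gauss_term_telescope by lra.
  assert (Hc1 : rpoch (c + 1) n = rpoch c n * (c + INR n) / c).
  { change (rpoch c n * (c + INR n)) with (rpoch c (S n)). rewrite rpoch_S_l. field. lra. }
  unfold gauss_term. rewrite Hc1.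
  generalize (rpoch_pos c n ltac:(lra)) (INR_fact_pos n) (pos_INR n). intros. field. lra.
Qed.

Lemma gauss_pos (a b c : R) : 0 < a -> 0 < b -> a + b < c -> 0 < gauss a b c.
Proof.
  intros Ha Hb Hc. assert (Hex := ex_series_gauss a b c Ha Hb Hc).
  unfold gauss. rewrite Series_incr_1 by exact Hex.
  assert (0 <= Series (fun k => gauss_term a b c (S k))).
  { apply is_lim_seq_ge_const with (2 := Series_correct _ (proj1 (ex_series_incr_1 _) Hex)).
    intros n. apply sum_n_nonneg. intros k. apply Rlt_le, gauss_term_pos; lra. }
  generalize (gauss_term_pos a b c 0 Ha Hb ltac:(lra)). lra.
Qed.

(** Evaluates the rows of the double series in [sum_n_diag_le]. The factor [(c)_n / (c - a)_n] is
    what replaces [c] by [c - a] as the third parameter of [F]. *)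
Lemma gauss_shift (a b c : R) (n : nat) : 0 < a -> 0 < b -> a + b < c ->
  gauss a (b + INR n) (c + INR n) = gauss a b c * (rpoch c n / rpoch (c - a) n).
Proof.
  intros Ha Hb Hc. induction n as [|n IH].
  - simpl. rewrite !Rplus_0_r. field.
  - assert (Hn := pos_INR n).
    assert (E := gauss_contiguous a (b + INR n) (c + INR n) Ha ltac:(lra) ltac:(lra)).
    rewrite S_INR, <- !Rplus_assoc. rewrite IH in E.
    assert (P := rpoch_pos (c - a) n ltac:(lra)).
    apply Rmult_eq_reg_l with (c + INR n - a); [|lra]. rewrite E. simpl. field. lra.
Qed.

(** In every term after the first, the leading factor [c] of [(c)_k] becomes [c + n], and the other
    factors of the denominator do not decrease. *)
Lemma gauss_large_c (a b c : R) (n : nat) : 0 < a -> 0 < b -> a + b < c ->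
  gauss a b (c + INR n) <= 1 + c / (c + INR n) * gauss a b c.
Proof.
  intros Ha Hb Hc. assert (Hn := pos_INR n).
  assert (Hex := ex_series_gauss a b c Ha Hb Hc).
  assert (Hex' := ex_series_gauss a b (c + INR n) Ha Hb ltac:(lra)).
  unfold gauss at 1. rewrite Series_incr_1 by exact Hex'.
  replace (gauss_term a b (c + INR n) 0) with 1 by (unfold gauss_term; simpl; field).
  apply Rplus_le_compat_l.
  assert (Hq : 0 < c / (c + INR n)) by (apply Rdiv_lt_0_compat; lra).
  assert (Hge : Series (fun k => gauss_term a b c (S k)) <= gauss a b c).
  { unfold gauss. rewrite (Series_incr_1 _ Hex).
    generalize (gauss_term_pos a b c 0 Ha Hb ltac:(lra)). lra. }
  apply Rle_trans with (c / (c + INR n) * Series (fun k => gauss_term a b c (S k)));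
    [|apply Rmult_le_compat_l; lra].
  rewrite <- Series_scal_l. apply Series_le.
  - intros k. split; [apply Rlt_le, gauss_term_pos; lra|].
    unfold gauss_term. rewrite !(rpoch_S_l c), !(rpoch_S_l (c + INR n)).
    assert (P1 := rpoch_pos a (S k) Ha). assert (P2 := rpoch_pos b (S k) Hb).
    assert (P3 := rpoch_pos (c + 1) k ltac:(lra)). assert (P4 := INR_fact_pos (S k)).
    assert (P5 := rpoch_le (c + 1) (c + INR n + 1) k ltac:(lra)).
    set (N := rpoch a (S k) * rpoch b (S k)). assert (PN : 0 < N) by now apply Rmult_lt_0_compat.
    replace (c / (c + INR n) * (N / (c * rpoch (c + 1) k * INR (fact (S k)))))
      with (N / ((c + INR n) * INR (fact (S k))) * / rpoch (c + 1) k) by (field; lra).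
    replace (N / ((c + INR n) * rpoch (c + INR n + 1) k * INR (fact (S k))))
      with (N / ((c + INR n) * INR (fact (S k))) * / rpoch (c + INR n + 1) k) by (field; lra).
    apply Rmult_le_compat_l.
    + apply Rlt_le, Rdiv_lt_0_compat; [exact PN|]. apply Rmult_lt_0_compat; lra.
    + apply Rinv_le_contravar; lra.
  - apply (ex_series_scal (V := R_NormedModule) (c / (c + INR n))).
    exact (proj1 (ex_series_incr_1 _) Hex).
Qed.
(** * The coefficients of (1 - t)^(-a) (1 + x t)^(-a) *)

Lemma sum_n_Sl (u : nat -> R) (n : nat) :
  sum_n u (S n) = u 0%nat + sum_n (fun k => u (S k)) n.
Proof.
  induction n as [|n IH].
  - rewrite sum_Sn, !sum_O. reflexivity.
  - rewrite sum_Sn, IH, sum_Sn. apply Rplus_assoc.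
Qed.

Lemma sum_n_SR (u : nat -> R) (n : nat) : sum_n u (S n) = sum_n u n + u (S n).
Proof. exact (sum_Sn u n). Qed.

Lemma sum_n_plusR (u v : nat -> R) (n : nat) :
  sum_n (fun k => u k + v k) n = sum_n u n + sum_n v n.
Proof. exact (sum_n_plus u v n). Qed.

Lemma sum_n_scalR (k : R) (u : nat -> R) (n : nat) :
  sum_n (fun i => k * u i) n = k * sum_n u n.
Proof. exact (sum_n_scal_l k u n). Qed.

Lemma sum_n_eqR (u v : nat -> R) (n : nat) :
  (forall k, (k <= n)%nat -> u k = v k) -> sum_n u n = sum_n v n.
Proof. exact (sum_n_ext_loc u v n). Qed.

(** The coefficient of [t^i] in [(1 - t)^(-a)]. *)
Definition bin_coef (a : R) (i : nat) : R := rpoch a i / INR (fact i).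

(* The coefficient of t^N in (1 - t)^(-a) (1 + x t)^(-a). *)
Definition diag_coef (a x : R) (N : nat) : R :=
  sum_n (fun i => bin_coef a i * (- x) ^ i * bin_coef a (N - i)) N.

(** The operator [t d/dt] is applied to the factor [(1 + x t)^(-a)] alone, and in [diag_moment_r] to
    [(1 - t)^(-a)] alone. Each factor satisfies a first-order differential equation, so both moments
    obey one-step recurrences. *)
Definition diag_moment_l (a x : R) (N : nat) : R :=
  sum_n (fun i => INR i * (bin_coef a i * (- x) ^ i * bin_coef a (N - i))) N.

Definition diag_moment_r (a x : R) (N : nat) : R :=
  sum_n (fun i => INR (N - i) * (bin_coef a i * (- x) ^ i * bin_coef a (N - i))) N.

Lemma bin_coef_S (a : R) (i : nat) : INR (S i) * bin_coef a (S i) = (a + INR i) * bin_coef a i.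
Proof.
  unfold bin_coef. rewrite fact_S_INR, S_INR. simpl rpoch.
  generalize (INR_fact_pos i) (pos_INR i). intros. field. lra.
Qed.

Lemma diag_moment_add (a x : R) (N : nat) :
  diag_moment_l a x N + diag_moment_r a x N = INR N * diag_coef a x N.
Proof.
  unfold diag_moment_l, diag_moment_r, diag_coef.
  rewrite <- sum_n_scalR, <- sum_n_plusR. apply sum_n_eqR. intros i Hi.
  rewrite minus_INR by exact Hi. ring.
Qed.

Lemma diag_moment_l_S (a x : R) (N : nat) :
  diag_moment_l a x (S N) = - x * (a * diag_coef a x N + diag_moment_l a x N).
Proof.
  unfold diag_moment_l, diag_coef. rewrite sum_n_Sl.
  rewrite <- sum_n_scalR, <- sum_n_plusR, <- sum_n_scalR. simpl INR at 1.
  rewrite Rmult_0_l, Rplus_0_l. apply sum_n_eqR. intros i _.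
  replace (S N - S i)%nat with (N - i)%nat by lia.
  transitivity ((INR (S i) * bin_coef a (S i)) * (- x) ^ S i * bin_coef a (N - i)); [ring|].
  rewrite bin_coef_S. simpl pow. ring.
Qed.

Lemma diag_moment_r_S (a x : R) (N : nat) :
  diag_moment_r a x (S N) = a * diag_coef a x N + diag_moment_r a x N.
Proof.
  unfold diag_moment_r, diag_coef. rewrite sum_n_SR, Nat.sub_diag.
  rewrite <- sum_n_scalR, <- sum_n_plusR. simpl INR at 2. rewrite Rmult_0_l, Rplus_0_r.
  apply sum_n_eqR. intros i Hi.
  replace (S N - i)%nat with (S (N - i)) by lia.
  transitivity (bin_coef a i * (- x) ^ i * (INR (S (N - i)) * bin_coef a (S (N - i)))); [ring|].
  rewrite bin_coef_S. ring.
Qed.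

(* The coefficients of (1 - t)^(-a) (1 + x t)^(-a) are nonnegative because those of its
   logarithm are, namely a (1 + (-x)^k) / k; the moments carry this through a recurrence. *)
Lemma diag_coef_nonneg (a x : R) (N : nat) : 0 < a -> 0 <= x <= 1 -> 0 <= diag_coef a x N.
Proof.
  intros Ha Hx.
  (* The last inequality is what the third needs at [S N], and its own induction step uses the
     second and third. *)
  assert (H : 0 <= diag_coef a x N /\ 0 <= diag_moment_r a x N /\
    0 <= diag_moment_l a x N + diag_moment_r a x N /\
    0 <= diag_moment_r a x N - x * diag_moment_l a x N); [|apply H].
  induction N as [|N (H1 & H2 & H3 & H4)].
  - unfold diag_coef, diag_moment_l, diag_moment_r. rewrite !sum_O.
    unfold bin_coef. simpl. lra.
  - assert (E := diag_moment_add a x (S N)).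
    rewrite diag_moment_l_S, diag_moment_r_S in *.
    set (d := diag_coef a x N) in *. set (U := diag_moment_r a x N) in *.
    set (V := diag_moment_l a x N) in *.
    assert (Had : 0 <= a * d) by (apply Rmult_le_pos; lra).
    assert (P2 : 0 <= a * d + U) by lra.
    assert (P3 : 0 <= - x * (a * d + V) + (a * d + U)).
    { replace (- x * (a * d + V) + (a * d + U)) with ((1 - x) * (a * d) + (U - x * V)) by ring.
      apply Rplus_le_le_0_compat; [apply Rmult_le_pos|]; lra. }
    repeat split; [|exact P2|exact P3|].
    + rewrite E in P3. apply Rmult_le_reg_l with (INR (S N)); [apply lt_0_INR; lia|]. lra.
    + replace (a * d + U - x * (- x * (a * d + V)))
        with ((1 + x * x) * (a * d) + (1 - x * x) * U + x * x * (V + U)) by ring.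
      assert (0 <= x * x <= 1) by nra.
      repeat apply Rplus_le_le_0_compat; apply Rmult_le_pos; lra.
Qed.

(** At [x = 1] the product is [(1 - t^2)^(-a)]. Over two steps of the moment recurrences the odd
    coefficient cancels, leaving the recurrence of [bin_coef]. *)
Lemma diag_coef_1_even (a : R) (m : nat) : diag_coef a 1 (2 * m) = bin_coef a m.
Proof.
  induction m as [|m IH].
  - unfold diag_coef. simpl. rewrite sum_O. unfold bin_coef. simpl. field.
  - replace (2 * S m)%nat with (S (S (2 * m))) by lia.
    assert (E := diag_moment_add a 1 (S (S (2 * m)))). assert (E0 := diag_moment_add a 1 (2 * m)).
    rewrite diag_moment_l_S, diag_moment_r_S, (diag_moment_l_S a 1 (2 * m)),
      (diag_moment_r_S a 1 (2 * m)) in E.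
    rewrite IH in *. assert (B := bin_coef_S a m).
    rewrite !S_INR, mult_INR in *. simpl (INR 2) in *.
    assert (Hm := pos_INR m).
    apply Rmult_eq_reg_l with (2 * (INR m + 1)); [|lra].
    transitivity (2 * ((a + INR m) * bin_coef a m)); [|rewrite <- B; ring].
    lra.
Qed.
(** * The Gauss function at -1 *)

Lemma is_lim_seq_sum_n (h : nat -> nat -> R) (l : nat -> R) (K : nat) :
  (forall i, is_lim_seq (h i) (l i)) -> is_lim_seq (fun M => sum_n (fun i => h i M) K) (sum_n l K).
Proof.
  intros H. induction K as [|K IH].
  - rewrite sum_O. apply is_lim_seq_ext with (2 := H 0%nat). intros M. now rewrite sum_O.
  - rewrite sum_n_SR.
    apply is_lim_seq_ext with (u := fun M => sum_n (fun i => h i M) K + h (S K) M).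
    + intros M. now rewrite sum_n_SR.
    + apply is_lim_seq_plus'; [exact IH|apply H].
Qed.

Lemma is_lim_seq_sub_l (u : nat -> R) (i : nat) (l : R) :
  is_lim_seq u l -> is_lim_seq (fun M => u (M - i)%nat) l.
Proof.
  intros H. apply (is_lim_seq_incr_n _ i).
  apply is_lim_seq_ext with (2 := H). intros n. f_equal. lia.
Qed.

Lemma sum_n_abs_tail (u b : nat -> R) (K M : nat) : (K <= M)%nat ->
  (forall i, Rabs (u i) <= b i) ->
  Rabs (sum_n u M) <= Rabs (sum_n u K) + (sum_n b M - sum_n b K).
Proof.
  intros HKM H. induction HKM as [|M HKM IH]; [lra|].
  rewrite !sum_n_SR. specialize (H (S M)). generalize (Rabs_triang (sum_n u M) (u (S M))). lra.
Qed.

(** Dominated convergence: rows beyond some [K] are controlled by the tail of [b], and each of the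
    finitely many others converges because [M - i] tends to infinity. It allows summation by rows
    when partial sums are taken along diagonals. *)
Lemma tannery_triangle (f : nat -> nat -> R) (l b : nat -> R) :
  (forall i j, Rabs (f i j) <= b i) -> ex_series b -> (forall i, is_lim_seq (f i) (l i)) ->
  is_lim_seq (fun M => sum_n (fun i => f i (M - i)%nat) M) (Series l).
Proof.
  intros Hf Hb Hl.
  assert (Hlb : forall i, Rabs (l i) <= b i).
  { intros i. apply (is_lim_seq_le (fun j => Rabs (f i j)) (fun _ => b i) (Rabs (l i)) (b i)).
    - intros j. apply Hf.
    - exact (is_lim_seq_abs _ _ (Hl i)).
    - apply is_lim_seq_const. }
  assert (Hls : ex_series l) by exact (ex_series_le_R l b Hlb Hb).
  set (h := fun i j => f i j - l i).
  assert (Hh : forall i j, Rabs (h i j) <= 2 * b i).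
  { intros i j. unfold h, Rminus. apply Rle_trans with (1 := Rabs_triang _ _).
    rewrite Rabs_Ropp. generalize (Hf i j) (Hlb i). lra. }
  assert (H0 : is_lim_seq (fun M => sum_n (fun i => h i (M - i)%nat) M) 0).
  { apply is_lim_seq_spec. intros eps. simpl.
    assert (Hb2 : is_lim_seq (sum_n (fun i => 2 * b i)) (2 * Series b)).
    { exact (is_series_scal 2 _ _ (Series_correct _ Hb)). }
    assert (He : 0 < eps / 2) by (generalize (cond_pos eps); lra).
    destruct (proj2 (is_lim_seq_spec _ _) Hb2 (mkposreal _ He)) as [K HK]. simpl in HK.
    assert (HhK : is_lim_seq (fun M => sum_n (fun i => h i (M - i)%nat) K) 0).
    { replace 0 with (sum_n (fun _ : nat => 0) K)
        by (rewrite sum_n_const; apply Rmult_0_r).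
      apply is_lim_seq_sum_n with (h := fun i M => h i (M - i)%nat). intros i.
      apply is_lim_seq_sub_l. unfold h.
      replace 0 with (l i - l i) by ring.
      apply is_lim_seq_minus'; [apply Hl|apply is_lim_seq_const]. }
    destruct (proj2 (is_lim_seq_spec _ _) HhK (mkposreal _ He)) as [N HN]. simpl in HN.
    exists (max K N). intros M HM. rewrite Rminus_0_r.
    apply Rle_lt_trans with (1 := sum_n_abs_tail (fun i => h i (M - i)%nat) (fun i => 2 * b i) K M
       ltac:(lia) (fun i => Hh i (M - i)%nat)).
    specialize (HN M ltac:(lia)). rewrite Rminus_0_r in HN.
    assert (HK1 := HK K ltac:(lia)).
    assert (Hinc : sum_n (fun i => 2 * b i) M <= 2 * Series b).
    { apply (is_lim_seq_incr_compare _ _ Hb2). intros n. rewrite sum_n_SR.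
      generalize (Hlb (S n)) (Rabs_pos (l (S n))). lra. }
    apply Rabs_lt_between in HK1. lra. }
  replace (Series l) with (0 + Series l) by ring.
  apply is_lim_seq_ext with (u := fun M => sum_n (fun i => h i (M - i)%nat) M + sum_n l M).
  - intros M. rewrite <- sum_n_plusR. apply sum_n_eqR. intros i _. unfold h. ring.
  - apply is_lim_seq_plus'; [exact H0|exact (Series_correct _ Hls)].
Qed.

Lemma sum_n_triangle (f : nat -> nat -> R) (M : nat) :
  sum_n (fun N => sum_n (fun i => f i (N - i)%nat) N) M =
  sum_n (fun i => sum_n (f i) (M - i)) M.
Proof.
  induction M as [|M IH]; [now rewrite !sum_O|].
  rewrite sum_n_SR, IH, !(sum_n_SR _ M), Nat.sub_diag, sum_O.
  rewrite <- Rplus_assoc, <- sum_n_plusR. f_equal. apply sum_n_eqR. intros i Hi.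
  replace (S M - i)%nat with (S (M - i)) by lia. now rewrite sum_n_SR.
Qed.

Lemma rpoch_C (x : R) (n : nat) : poch (RtoC x) n = RtoC (rpoch x n).
Proof.
  induction n as [|n IH]; [reflexivity|].
  simpl. rewrite IH, <- RtoC_plus, <- RtoC_mult. reflexivity.
Qed.

Lemma rpoch_1 (n : nat) : rpoch 1 n = INR (fact n).
Proof.
  induction n as [|n IH]; [reflexivity|]. rewrite fact_S_INR. simpl. rewrite IH. ring.
Qed.

Lemma hyp2F1_coef_R (a b c : R) (n : nat) : 0 < c ->
  hyp2F1_coef (RtoC a) (RtoC b) (RtoC c) n = RtoC (gauss_term a b c n).
Proof.
  intros Hc. unfold hyp2F1_coef, gauss_term.
  rewrite !rpoch_C, rpoch_1, <- !RtoC_mult, <- RtoC_div; [reflexivity|].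
  generalize (rpoch_pos c n Hc) (INR_fact_pos n). intros. apply Rgt_not_eq.
  now apply Rmult_lt_0_compat.
Qed.

Lemma is_series_Re (u : nat -> C) (l : C) :
  is_cseries u l -> is_series (fun n => Re (u n)) (Re l).
Proof.
  intros H.
  assert (H1 : filterlim (fun n => Re (sum_n (G := C_NormedModule) u n)) eventually (locally (Re l))).
  { apply filterlim_comp with (1 := H). intros P [eps HP]. exists eps.
    intros y [B _]. now apply HP. }
  apply filterlim_ext with (2 := H1). intros n. now rewrite sum_n_C.
Qed.

Lemma hyp2F1_series_R (a b c x : R) (F : C -> C) : 0 < c -> Rabs x < 1 ->
  is_hyp2F1 (RtoC a) (RtoC b) (RtoC c) F ->
  is_series (fun n => gauss_term a b c n * x ^ n) (Re (F (RtoC x))).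
Proof.
  intros Hc Hx [HF _].
  assert (H : is_cseries (fun n => RtoC (gauss_term a b c n * x ^ n)) (F (RtoC x))).
  { apply is_series_ext with (2 := HF (RtoC x) ltac:(rewrite <- Cmod_R in Hx; exact Hx)).
    intros n. rewrite hyp2F1_coef_R by exact Hc.
    transitivity (pow_n (K := C_Ring) (RtoC x) n * gauss_term a b c n)%C; [reflexivity|].
    rewrite (pow_n_Cpow x n : pow_n (K := C_Ring) (RtoC x) n = (x ^ n)%C).
    now rewrite <- RtoC_pow, <- RtoC_mult, Rmult_comm. }
  exact (is_series_Re _ _ H).
Qed.

Definition quad_term (a b c : R) (m : nat) : R :=
  rpoch a m * rpoch b (2 * m) / (rpoch c (2 * m) * INR (fact m)).

(** Since [(y)_N = (y)_i (y + i)_(N-i)], expanding [d_N] turns the sum into a double series whose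
    row [i] is a Gauss series with parameters [b + i], [c + i]. Summing the rows first yields the
    product on the right as the limit, and the nonnegativity of [d_N] makes it a bound for every
    partial sum. *)
Lemma sum_n_diag_le (a b c x : R) (F : C -> C) (M : nat) :
  0 < a -> 0 < b -> a + b < c -> 0 <= x < 1 ->
  is_hyp2F1 (RtoC a) (RtoC b) (RtoC (c - a)) F ->
  sum_n (fun N => rpoch b N / rpoch c N * diag_coef a x N) M <=
  gauss a b c * Re (F (RtoC (- x))).
Proof.
  intros Ha Hb Hc Hx HF.
  assert (Hbc : forall n, 0 < rpoch b n / rpoch c n).
  { intros n. apply Rdiv_lt_0_compat; apply rpoch_pos; lra. }
  set (S n := gauss a (b + INR n) (c + INR n)).
  set (k n := rpoch b n / rpoch c n * bin_coef a n).
  assert (Hk : forall n, 0 < k n).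
  { intros n. apply Rmult_lt_0_compat; [apply Hbc|].
    apply Rdiv_lt_0_compat; [now apply rpoch_pos|apply INR_fact_pos]. }
  assert (HkS : forall n, k n * S n = gauss a b c * gauss_term a b (c - a) n).
  { intros n. unfold k, S. rewrite gauss_shift by assumption. unfold gauss_term, bin_coef.
    generalize (rpoch_pos c n ltac:(lra)) (rpoch_pos (c - a) n ltac:(lra)) (INR_fact_pos n).
    intros. field. lra. }
  (* Row [i] truncated at [j]; the diagonals up to [M] contain exactly the truncation of row [i] at
     [M - i]. *)
  set (f i j := k i * (- x) ^ i * sum_n (gauss_term a (b + INR i) (c + INR i)) j).
  assert (Hg : forall i, is_lim_seq (sum_n (gauss_term a (b + INR i) (c + INR i))) (S i)).
  { intros i. apply Series_correct, ex_series_gauss; generalize (pos_INR i); lra. }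
  assert (Hgle : forall i j, 0 <= sum_n (gauss_term a (b + INR i) (c + INR i)) j <= S i).
  { intros i j.
    assert (Hp : forall n, 0 <= gauss_term a (b + INR i) (c + INR i) n).
    { intros n. apply Rlt_le, gauss_term_pos; generalize (pos_INR i); lra. }
    split; [now apply sum_n_nonneg|].
    apply (is_lim_seq_incr_compare _ _ (Hg i)). intros n. rewrite sum_n_SR.
    specialize (Hp (Datatypes.S n)). lra. }
  assert (HT : is_lim_seq (fun M => sum_n (fun i => f i (M - i)%nat) M)
     (Series (fun i => k i * (- x) ^ i * S i))).
  { apply tannery_triangle with (b := fun i => k i * x ^ i * S i).
    - intros i j. unfold f. rewrite !Rabs_mult, <- RPow_abs, Rabs_Ropp.
      rewrite (Rabs_pos_eq x), (Rabs_pos_eq (k i)), (Rabs_pos_eq (sum_n _ _)).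
      + apply Rmult_le_compat_l; [|apply Hgle].
        apply Rmult_le_pos; [apply Rlt_le, Hk|apply pow_le; lra].
      + apply Hgle.
      + apply Rlt_le, Hk.
      + lra.
    - assert (HE : forall i, gauss a b c * (gauss_term a b (c - a) i * x ^ i) = k i * x ^ i * S i).
      { intros i. transitivity (gauss a b c * gauss_term a b (c - a) i * x ^ i); [ring|].
        rewrite <- HkS. ring. }
      apply (ex_series_ext _ _ HE).
      apply (ex_series_scal (V := R_NormedModule) (gauss a b c)).
      exists (Re (F (RtoC x))). apply hyp2F1_series_R; [lra| |exact HF].
      rewrite Rabs_pos_eq; lra.
    - intros i. apply (is_lim_seq_scal_l _ (k i * (- x) ^ i) (S i)), Hg. }
  assert (HS : Series (fun i => k i * (- x) ^ i * S i) = gauss a b c * Re (F (RtoC (- x)))).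
  { rewrite <- (is_series_unique _ _ (hyp2F1_series_R a b (c - a) (- x) F ltac:(lra)
      ltac:(rewrite Rabs_Ropp, Rabs_pos_eq; lra) HF)).
    rewrite <- Series_scal_l. apply Series_ext. intros i.
    transitivity (k i * S i * (- x) ^ i); [ring|]. rewrite HkS. ring. }
  rewrite HS in HT.
  assert (HD : forall M, sum_n (fun i => f i (M - i)%nat) M =
    sum_n (fun N => rpoch b N / rpoch c N * diag_coef a x N) M).
  { intros M'. unfold f.
    rewrite <- (sum_n_eqR (fun i => sum_n (fun j => k i * (- x) ^ i *
        gauss_term a (b + INR i) (c + INR i) j) (M' - i)))
      by (intros i _; apply sum_n_scalR).
    rewrite <- sum_n_triangle. apply sum_n_eqR. intros N _.
    unfold diag_coef. rewrite <- sum_n_scalR. apply sum_n_eqR. intros i Hi.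
    unfold k, gauss_term, bin_coef.
    assert (EN : forall y, rpoch y N = rpoch y i * rpoch (y + INR i) (N - i)).
    { intros y. rewrite <- rpoch_add. f_equal. lia. }
    rewrite (EN b), (EN c).
    generalize (rpoch_pos c i ltac:(lra)) (INR_fact_pos i) (INR_fact_pos (N - i))
      (rpoch_pos (c + INR i) (N - i) ltac:(generalize (pos_INR i); lra)).
    intros. field. lra. }
  assert (HT' := is_lim_seq_ext _ _ _ HD HT).
  apply (is_lim_seq_incr_compare _ _ HT'). intros n. rewrite sum_n_SR.
  generalize (Rmult_le_pos _ _ (Rlt_le _ _ (Hbc (Datatypes.S n)))
    (diag_coef_nonneg a x (Datatypes.S n) Ha ltac:(lra))). lra.
Qed.

(** * The limit as x tends to 1 *)

Lemma is_lim_seq_pow (u : nat -> R) (l : R) (i : nat) :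
  is_lim_seq u l -> is_lim_seq (fun n => u n ^ i) (l ^ i).
Proof.
  intros Hu. induction i as [|i IH]; [apply is_lim_seq_const|].
  apply is_lim_seq_mult'; assumption.
Qed.

Lemma is_lim_seq_Re_of_ex_derive (F : C -> C) (u : nat -> R) (l : R) :
  ex_derive (K := C_AbsRing) (V := C_NormedModule) F (RtoC l) ->
  is_lim_seq u l -> is_lim_seq (fun n => Re (F (RtoC (u n)))) (Re (F (RtoC l))).
Proof.
  intros HF Hu. apply ex_derive_continuous in HF.
  apply is_lim_seq_spec. intros eps.
  destruct (HF (fun w => Rabs (Re w - Re (F (RtoC l))) < eps)) as [d Hd].
  - exists eps. intros w [B _]. exact B.
  - destruct (proj2 (is_lim_seq_spec _ _) Hu d) as [N HN]. simpl in HN.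
    exists N. intros n Hn. apply Hd.
    change (Cmod (RtoC (u n) - RtoC l)%C < d). rewrite <- RtoC_minus, Cmod_R. now apply HN.
Qed.

(** The even-indexed terms on the right are exactly the [quad_term]s; the odd ones are discarded as
    nonnegative. *)
Lemma sum_n_quad_le_diag (a b c : R) (M : nat) : 0 < a -> 0 < b -> 0 < c ->
  sum_n (quad_term a b c) M <=
  sum_n (fun N => rpoch b N / rpoch c N * diag_coef a 1 N) (2 * M).
Proof.
  intros Ha Hb Hc.
  assert (E : forall m, quad_term a b c m =
    rpoch b (2 * m) / rpoch c (2 * m) * diag_coef a 1 (2 * m)).
  { intros m. rewrite diag_coef_1_even. unfold quad_term, bin_coef.
    generalize (rpoch_pos c (2 * m) Hc) (INR_fact_pos m). intros. field. lra. }
  induction M as [|M IH].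
  - change (2 * 0)%nat with 0%nat. rewrite !sum_O. right. apply E.
  - replace (2 * S M)%nat with (S (S (2 * M))) by lia. rewrite !sum_n_SR, E.
    replace (2 * S M)%nat with (S (S (2 * M))) by lia.
    assert (0 <= rpoch b (S (2 * M)) / rpoch c (S (2 * M)) * diag_coef a 1 (S (2 * M))).
    { apply Rmult_le_pos; [|apply diag_coef_nonneg; lra].
      apply Rlt_le, Rdiv_lt_0_compat; now apply rpoch_pos. }
    lra.
Qed.

(** The limit is taken with [M] fixed: the left side is then a polynomial in [x], and the right side
    converges because the continuation is differentiable, hence continuous, at -1. *)
Lemma sum_n_quad_le (a b c : R) (F : C -> C) (M : nat) :
  0 < a -> 0 < b -> a + b < c ->
  is_hyp2F1 (RtoC a) (RtoC b) (RtoC (c - a)) F ->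
  sum_n (quad_term a b c) M <= gauss a b c * Re (F (RtoC (- 1))).
Proof.
  intros Ha Hb Hc HF.
  apply Rle_trans with (1 := sum_n_quad_le_diag a b c M Ha Hb ltac:(lra)).
  set (x := fun n => 1 - / (INR n + 1)).
  assert (Hi : forall n, 0 < / (INR n + 1) <= 1).
  { intros n. assert (Hn := pos_INR n). split; [apply Rinv_0_lt_compat; lra|].
    rewrite <- Rinv_1. apply Rinv_le_contravar; lra. }
  assert (Hx : is_lim_seq x 1).
  { replace 1 with (1 - 0) at 1 by ring. apply is_lim_seq_minus'; [apply is_lim_seq_const|].
    apply is_lim_seq_ext with (u := fun n => / INR (S n)); [intros n; now rewrite S_INR|].
    apply (is_lim_seq_incr_1 (fun n => / INR n)).
    apply (is_lim_seq_inv _ p_infty is_lim_seq_INR). discriminate. }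
  assert (Hnx : is_lim_seq (fun n => - x n) (- 1)) by exact (proj1 (is_lim_seq_opp _ _) Hx).
  apply (is_lim_seq_le
    (fun n => sum_n (fun N => rpoch b N / rpoch c N * diag_coef a (x n) N) (2 * M))
    (fun n => gauss a b c * Re (F (RtoC (- x n))))
    (sum_n (fun N => rpoch b N / rpoch c N * diag_coef a 1 N) (2 * M))
    (gauss a b c * Re (F (RtoC (- 1))))).
  - intros n. apply sum_n_diag_le; try assumption. unfold x. generalize (Hi n). lra.
  - apply is_lim_seq_sum_n with (h := fun N n => rpoch b N / rpoch c N * diag_coef a (x n) N).
    intros N. apply (is_lim_seq_scal_l _ _ (diag_coef a 1 N)).
    apply is_lim_seq_sum_n with (h := fun i n => bin_coef a i * (- x n) ^ i * bin_coef a (N - i)).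
    intros i. apply (is_lim_seq_scal_r _ _ (bin_coef a i * (- 1) ^ i)).
    apply (is_lim_seq_scal_l _ _ ((- 1) ^ i)). now apply is_lim_seq_pow.
  - apply (is_lim_seq_scal_l _ _ (Re (F (RtoC (- 1))))).
    apply is_lim_seq_Re_of_ex_derive; [|exact Hnx].
    apply HF. intros [_ H]. simpl in H. lra.
Qed.
(** * The Gamma function *)

(** For a nonnegative integrand the improper integral is the supremum of the proper ones. Upper
    bounds for Gamma can thus be checked on compact intervals. *)
Lemma is_RInt_gen_sup (f : R -> R) (M : R) :
  (forall t, 0 < t -> continuous f t) -> (forall t, 0 < t -> 0 <= f t) ->
  (forall a b, 0 < a <= b -> RInt f a b <= M) ->
  exists l, is_RInt_gen f (at_right 0) (Rbar_locally p_infty) l /\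
    is_lub (fun y => exists a b, 0 < a <= b /\ y = RInt f a b) l.
Proof.
  intros Hc Hf HM.
  destruct (completeness (fun y => exists a b, 0 < a <= b /\ y = RInt f a b)) as [l Hl].
  - exists M. intros y (a & b & Hab & ->). now apply HM.
  - exists (RInt f 1 1), 1, 1. split; [lra|reflexivity].
  - exists l. split; [|exact Hl].
    assert (Hex : forall a b, 0 < a <= b -> ex_RInt f a b).
    { intros a b Hab. apply (ex_RInt_continuous (V := R_CompleteNormedModule)). intros t Ht.
      apply Hc. rewrite Rmin_left in Ht; lra. }
    assert (Hmono : forall a b a' b', 0 < a' <= a -> a <= b <= b' -> RInt f a b <= RInt f a' b').
    { intros a b a' b' Ha Hb.
      rewrite <- (RInt_Chasles f a' a b') by (apply Hex; lra).
      rewrite <- (RInt_Chasles f a b b') by (apply Hex; lra).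
      assert (0 <= RInt f a' a).
      { apply RInt_ge_0; [lra|apply Hex; lra|]. intros t Ht. apply Hf. lra. }
      assert (0 <= RInt f b b').
      { apply RInt_ge_0; [lra|apply Hex; lra|]. intros t Ht. apply Hf. lra. }
      change plus with Rplus. lra. }
    intros P [eps HP].
    assert (Hclose : exists a b, 0 < a <= b /\ l - eps < RInt f a b).
    { destruct (Classical_Prop.classic (exists a b, 0 < a <= b /\ l - eps < RInt f a b)) as [H|H];
        [exact H|exfalso].
      assert (Hub : l <= l - eps).
      { apply Hl. intros y (a & b & Hab & ->). apply Rnot_lt_le. intros Hlt. apply H. now exists a, b. }
      generalize (cond_pos eps). lra. }
    destruct Hclose as (a & b & Hab & Hlt).
    apply Filter_prod with (Q := fun t => 0 < t <= a) (R := fun t => b < t).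
    + exists (mkposreal a (proj1 Hab)). intros t Ht Ht0. split; [exact Ht0|].
      change (Rabs (t - 0) < a) in Ht. rewrite Rminus_0_r, Rabs_pos_eq in Ht; lra.
    + exists b. auto.
    + intros a' b' Ha' Hb'. exists (RInt f a' b'). split.
      * apply (RInt_correct (V := R_CompleteNormedModule)), Hex. simpl. lra.
      * apply HP. change (Rabs (RInt f a' b' - l) < eps).
        assert (H1 := Hmono a b a' b' ltac:(lra) ltac:(lra)).
        assert (H2 : RInt f a' b' <= l).
        { apply Hl. exists a', b'. split; [lra|reflexivity]. }
        apply Rabs_lt_between. generalize (cond_pos eps). lra.
Qed.

Definition Gamma_integrand (x t : R) : R := Rpower t (x - 1) * exp (- t).

Lemma Gamma_integrand_exp (x t : R) : Gamma_integrand x t = exp ((x - 1) * ln t - t).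
Proof. unfold Gamma_integrand, Rpower. rewrite <- exp_plus. f_equal. Qed.

Lemma Gamma_integrand_pos (x t : R) : 0 < Gamma_integrand x t.
Proof. rewrite Gamma_integrand_exp. apply exp_pos. Qed.

Lemma continuous_Gamma_integrand (x t : R) : 0 < t -> continuous (Gamma_integrand x) t.
Proof.
  intros Ht. apply (ex_derive_continuous (V := R_NormedModule)).
  unfold Gamma_integrand, Rpower. auto_derive. exact Ht.
Qed.

Lemma ex_RInt_Gamma_integrand (x a b : R) : 0 < a <= b -> ex_RInt (Gamma_integrand x) a b.
Proof.
  intros Hab. apply (ex_RInt_continuous (V := R_CompleteNormedModule)). intros t Ht.
  apply continuous_Gamma_integrand. rewrite Rmin_left in Ht; lra.
Qed.

(** The maximum is at [t = y]; this is [ln u <= u - 1] at [u = t / y]. *)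
Lemma Rpower_exp_max (y t : R) : 0 < y -> 0 < t ->
  Rpower t y * exp (- t) <= Rpower y y * exp (- y).
Proof.
  intros Hy Ht. unfold Rpower. rewrite <- !exp_plus.
  assert (H : ln t - ln y <= t / y - 1).
  { rewrite <- ln_div by lra. assert (0 < t / y) by now apply Rdiv_lt_0_compat.
    rewrite <- (ln_exp (t / y - 1)). apply ln_le; [assumption|].
    generalize (exp_ineq1_le (t / y - 1)). lra. }
  assert (H' : y * (ln t - ln y) <= t - y).
  { replace (t - y) with (y * (t / y - 1)) by (field; lra). apply Rmult_le_compat_l; lra. }
  destruct (Req_dec (y * ln t + - t) (y * ln y + - y)) as [->|Hne]; [lra|].
  apply Rlt_le, exp_increasing. lra.
Qed.

(* t^(x-1) exp(-t) is dominated by a multiple of the derivative of the bounded function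
   -1/(1 + t^x). *)
Lemma RInt_Gamma_integrand_bounded (x : R) : 0 < x ->
  exists M, forall a b, 0 < a <= b -> RInt (Gamma_integrand x) a b <= M.
Proof.
  intros Hx.
  (* [K] bounds [exp (-t) (1 + t^x)^2], through [(1 + p)^2 <= 2 + 2 p^2] and the maximum of
     [t^(2x) exp (-t)]. *)
  set (K := 2 + 2 * (Rpower (2 * x) (2 * x) * exp (- (2 * x)))).
  assert (HK : 0 < K).
  { unfold K. generalize (exp_pos (- (2 * x))) (exp_pos (2 * x * ln (2 * x))).
    unfold Rpower. intros. nra. }
  set (phi := fun t => - (K / x) / (1 + exp (x * ln t))).
  set (dphi := fun t => K * Rpower t (x - 1) / (1 + Rpower t x) ^ 2).
  exists (K / x). intros a b Hab.
  assert (HI : is_RInt dphi a b (phi b - phi a)).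
  { apply (is_RInt_derive phi dphi).
    - intros t Ht. rewrite Rmin_left in Ht by lra. unfold phi, dphi, Rpower.
      assert (E := exp_pos (x * ln t)).
      auto_derive; [lra|].
      replace ((x - 1) * ln t) with (x * ln t + - ln t) by ring.
      rewrite exp_plus, exp_Ropp, exp_ln by lra. field. lra.
    - intros t Ht. rewrite Rmin_left in Ht by lra.
      apply (ex_derive_continuous (V := R_NormedModule)). unfold dphi, Rpower.
      assert (E := exp_pos (x * ln t)).
      auto_derive. repeat split; try lra. apply Rgt_not_eq.
      apply Rmult_lt_0_compat; nra. }
  apply Rle_trans with (RInt dphi a b).
  - apply RInt_le; [lra|now apply ex_RInt_Gamma_integrand|eexists; exact HI|].
    intros t Ht. unfold Gamma_integrand, dphi.
    assert (E1 : 0 < Rpower t (x - 1)) by apply exp_pos.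
    assert (E2 : 0 < Rpower t x) by apply exp_pos.
    assert (E3 := exp_pos (- t)).
    assert (E4 : exp (- t) <= 1).
    { rewrite <- exp_0. apply Rlt_le, exp_increasing. lra. }
    assert (E5 := Rpower_exp_max (2 * x) t ltac:(lra) ltac:(lra)).
    replace (Rpower t (2 * x)) with (Rpower t x ^ 2) in E5.
    2:{ unfold Rpower. simpl. rewrite Rmult_1_r, <- exp_plus. f_equal. ring. }
    unfold Rdiv. rewrite (Rmult_comm K), Rmult_assoc. apply Rmult_le_compat_l; [lra|].
    apply -> Rle_div_r; [|apply pow_lt; lra].
    set (p := Rpower t x) in *.
    assert ((1 + p) ^ 2 <= 2 + 2 * p ^ 2) by (generalize (pow2_ge_0 (p - 1)); simpl; lra).
    apply Rle_trans with (exp (- t) * (2 + 2 * p ^ 2)).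
    + apply Rmult_le_compat_l; lra.
    + unfold K. lra.
  - rewrite (is_RInt_unique _ _ _ _ HI). unfold phi.
    assert (Ea := exp_pos (x * ln a)). assert (Eb := exp_pos (x * ln b)).
    assert (Hd : 0 < K / x) by now apply Rdiv_lt_0_compat.
    set (pa := exp (x * ln a)) in *. set (pb := exp (x * ln b)) in *.
    assert (0 < K / x * / (1 + pb)) by (apply Rmult_lt_0_compat; [lra|apply Rinv_0_lt_compat; lra]).
    assert (H1 : / (1 + pa) <= 1).
    { rewrite <- Rinv_1. apply Rinv_le_contravar; lra. }
    assert (K / x * / (1 + pa) <= K / x * 1) by (apply Rmult_le_compat_l; lra).
    unfold Rdiv in *. lra.
Qed.

Lemma Gamma_lub (x : R) : 0 < x ->
  is_lub (fun y => exists a b, 0 < a <= b /\ y = RInt (Gamma_integrand x) a b) (Gamma x).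
Proof.
  intros Hx. destruct (RInt_Gamma_integrand_bounded x Hx) as [M HM].
  destruct (is_RInt_gen_sup (Gamma_integrand x) M) as [l [Hl Hlub]].
  - intros t Ht. now apply continuous_Gamma_integrand.
  - intros t _. apply Rlt_le, Gamma_integrand_pos.
  - exact HM.
  - assert (E : Gamma x = l) by exact (is_RInt_gen_unique _ _ Hl).
    rewrite E. exact Hlub.
Qed.

Lemma RInt_le_Gamma (x a b : R) : 0 < x -> 0 < a <= b -> RInt (Gamma_integrand x) a b <= Gamma x.
Proof. intros Hx Hab. apply (Gamma_lub x Hx). now exists a, b. Qed.

Lemma Gamma_le (x l : R) : 0 < x ->
  (forall a b, 0 < a <= b -> RInt (Gamma_integrand x) a b <= l) -> Gamma x <= l.
Proof. intros Hx H. apply (Gamma_lub x Hx). intros y (a & b & Hab & ->). now apply H. Qed.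

Lemma Gamma_pos (x : R) : 0 < x -> 0 < Gamma x.
Proof.
  intros Hx. apply Rlt_le_trans with (2 := RInt_le_Gamma x 1 2 Hx ltac:(lra)).
  apply RInt_gt_0; [lra|intros t _; apply Gamma_integrand_pos|].
  intros t Ht. apply continuous_Gamma_integrand. lra.
Qed.

Lemma Gamma_integrand_parts (x a b : R) : 0 < a <= b ->
  RInt (Gamma_integrand (x + 1)) a b =
  Gamma_integrand (x + 1) a - Gamma_integrand (x + 1) b + x * RInt (Gamma_integrand x) a b.
Proof.
  intros Hab.
  assert (H1 : is_RInt (fun t => x * Gamma_integrand x t - Gamma_integrand (x + 1) t) a b
    (Gamma_integrand (x + 1) b - Gamma_integrand (x + 1) a)).
  { apply (is_RInt_derive (Gamma_integrand (x + 1))).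
    - intros t Ht. rewrite Rmin_left in Ht by lra.
      apply is_derive_ext with (f := fun s => Rpower s x * exp (- s)).
      { intros s. unfold Gamma_integrand. now replace (x + 1 - 1) with x by ring. }
      unfold Gamma_integrand. replace (x + 1 - 1) with x by ring. unfold Rpower.
      auto_derive; [lra|].
      replace ((x - 1) * ln t) with (x * ln t + - ln t) by ring.
      rewrite exp_plus, (exp_Ropp (ln t)), exp_ln by lra. field. lra.
    - intros t Ht. rewrite Rmin_left in Ht by lra.
      apply (continuous_minus (V := R_NormedModule)).
      + apply (continuous_scal_r (V := R_NormedModule)). apply continuous_Gamma_integrand. lra.
      + apply continuous_Gamma_integrand. lra. }
  assert (H2 := is_RInt_minus _ _ _ _ _ _
    (is_RInt_scal _ _ _ x _ (RInt_correct _ _ _ (ex_RInt_Gamma_integrand x a b Hab)))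
    (RInt_correct _ _ _ (ex_RInt_Gamma_integrand (x + 1) a b Hab))).
  assert (E := is_RInt_unique _ _ _ _ H1). assert (E2 := is_RInt_unique _ _ _ _ H2).
  change (RInt (fun t => x * Gamma_integrand x t - Gamma_integrand (x + 1) t) a b =
    x * RInt (Gamma_integrand x) a b - RInt (Gamma_integrand (x + 1)) a b) in E2.
  rewrite E in E2. lra.
Qed.

Lemma Gamma_integrand_small_at_0 (x a eps : R) : 0 < x -> 0 < a -> 0 < eps ->
  exists t, 0 < t <= a /\ Gamma_integrand (x + 1) t <= eps.
Proof.
  intros Hx Ha Heps. exists (Rmin a (exp (ln eps / x))).
  assert (Hm : 0 < Rmin a (exp (ln eps / x))) by (apply Rmin_pos; [exact Ha|apply exp_pos]).
  split; [split; [exact Hm|apply Rmin_l]|].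
  rewrite Gamma_integrand_exp. replace (x + 1 - 1) with x by ring.
  set (m := Rmin a (exp (ln eps / x))) in *.
  assert (Hl : ln m <= ln eps / x).
  { rewrite <- (ln_exp (ln eps / x)). apply ln_le; [exact Hm|apply Rmin_r]. }
  assert (Hxl : x * ln m <= ln eps).
  { replace (ln eps) with (x * (ln eps / x)) by (field; lra). apply Rmult_le_compat_l; lra. }
  rewrite <- (exp_ln eps) by exact Heps. apply Rlt_le, exp_increasing. lra.
Qed.

Lemma Gamma_integrand_small_at_infty (x b eps : R) : 0 < x -> 0 < b -> 0 < eps ->
  exists t, b <= t /\ Gamma_integrand (x + 1) t <= eps.
Proof.
  intros Hx Hb Heps.
  (* [K] is the maximum of [t^(x+1) exp (-t)], so the integrand is at most [K / t]. *)
  set (K := Rpower (x + 1) (x + 1) * exp (- (x + 1))).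
  assert (HK : 0 < K) by (apply Rmult_lt_0_compat; apply exp_pos).
  assert (Hm := Rmax_l b (K / eps)). assert (Hm' := Rmax_r b (K / eps)).
  set (t := Rmax b (K / eps)) in *. exists t. split; [exact Hm|].
  assert (H := Rpower_exp_max (x + 1) t ltac:(lra) ltac:(lra)). fold K in H.
  rewrite Rpower_plus, Rpower_1 in H by lra.
  unfold Gamma_integrand. replace (x + 1 - 1) with x by ring.
  apply Rmult_le_reg_r with t; [lra|].
  apply Rle_trans with K; [lra|].
  replace K with (eps * (K / eps)) by (field; lra). apply Rmult_le_compat_l; lra.
Qed.

(** Integration by parts. Each inequality enlarges the interval at one end only, to make that
    boundary term small; the boundary term at the other end has the favourable sign. *)
Lemma Gamma_S (x : R) : 0 < x -> Gamma (x + 1) = x * Gamma x.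
Proof.
  intros Hx. apply Rle_antisym.
  - apply Gamma_le; [lra|]. intros a b Hab. apply le_epsilon. intros eps Heps.
    destruct (Gamma_integrand_small_at_0 x a eps Hx (proj1 Hab) Heps) as [t [Ht Hs]].
    assert (H0 : 0 <= RInt (Gamma_integrand (x + 1)) t a).
    { apply RInt_ge_0; [lra|apply ex_RInt_Gamma_integrand; lra|].
      intros s _. apply Rlt_le, Gamma_integrand_pos. }
    assert (H1 : RInt (Gamma_integrand (x + 1)) t a + RInt (Gamma_integrand (x + 1)) a b
      = RInt (Gamma_integrand (x + 1)) t b).
    { apply (RInt_Chasles (Gamma_integrand (x + 1))); apply ex_RInt_Gamma_integrand; lra. }
    assert (H2 := Gamma_integrand_parts x t b ltac:(lra)).
    assert (H3 := RInt_le_Gamma x t b Hx ltac:(lra)).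
    assert (H4 := Gamma_integrand_pos (x + 1) b).
    assert (H5 : x * RInt (Gamma_integrand x) t b <= x * Gamma x) by (apply Rmult_le_compat_l; lra).
    lra.
  - apply Rmult_le_reg_l with (/ x); [now apply Rinv_0_lt_compat|].
    rewrite <- Rmult_assoc, Rinv_l, Rmult_1_l by lra.
    apply Gamma_le; [exact Hx|]. intros a b Hab.
    apply Rmult_le_reg_l with x; [exact Hx|].
    rewrite <- Rmult_assoc, Rinv_r, Rmult_1_l by lra.
    apply le_epsilon. intros eps Heps.
    destruct (Gamma_integrand_small_at_infty x b eps Hx ltac:(lra) Heps) as [t [Ht Hs]].
    assert (H0 : 0 <= RInt (Gamma_integrand x) b t).
    { apply RInt_ge_0; [lra|apply ex_RInt_Gamma_integrand; lra|].
      intros s _. apply Rlt_le, Gamma_integrand_pos. }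
    assert (H1 : RInt (Gamma_integrand x) a b + RInt (Gamma_integrand x) b t
      = RInt (Gamma_integrand x) a t).
    { apply (RInt_Chasles (Gamma_integrand x)); apply ex_RInt_Gamma_integrand; lra. }
    assert (H2 := Gamma_integrand_parts x a t ltac:(lra)).
    assert (H3 := RInt_le_Gamma (x + 1) a t ltac:(lra) ltac:(lra)).
    assert (H4 := Gamma_integrand_pos (x + 1) a).
    assert (H5 : x * RInt (Gamma_integrand x) a b <= x * RInt (Gamma_integrand x) a t)
      by (apply Rmult_le_compat_l; lra).
    lra.
Qed.

Lemma exp_convex (s u v : R) : 0 <= s <= 1 ->
  exp (s * u + (1 - s) * v) <= s * exp u + (1 - s) * exp v.
Proof.
  intros Hs. set (m := s * u + (1 - s) * v).
  assert (H : forall w, exp m * (1 + (w - m)) <= exp w).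
  { intros w. replace (exp w) with (exp m * exp (w - m)) by (rewrite <- exp_plus; f_equal; ring).
    apply Rmult_le_compat_l; [apply Rlt_le, exp_pos|apply exp_ineq1_le]. }
  replace (exp m) with (s * (exp m * (1 + (u - m))) + (1 - s) * (exp m * (1 + (v - m))))
    by (unfold m; ring).
  apply Rplus_le_compat; apply Rmult_le_compat_l; try lra; apply H.
Qed.

(** Hölder's inequality proved pointwise: convexity of [exp] is applied to the integrands normalised
    by [Gamma x] and [Gamma y], then integrated. The constants satisfy
    [kx * Gamma x + ky * Gamma y = exp m]. *)
Lemma Gamma_log_convex (s x y : R) : 0 < x -> 0 < y -> 0 <= s <= 1 ->
  Gamma (s * x + (1 - s) * y) <= exp (s * ln (Gamma x) + (1 - s) * ln (Gamma y)).
Proof.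
  intros Hx Hy Hs.
  assert (Px := Gamma_pos x Hx). assert (Py := Gamma_pos y Hy).
  set (m := s * ln (Gamma x) + (1 - s) * ln (Gamma y)).
  set (z := s * x + (1 - s) * y).
  assert (Hz : 0 < z).
  { unfold z. destruct (Rle_lt_or_eq_dec 0 s (proj1 Hs)) as [H|<-]; [|lra].
    apply Rplus_lt_le_0_compat; [now apply Rmult_lt_0_compat|apply Rmult_le_pos; lra]. }
  apply Gamma_le; [exact Hz|]. intros a b Hab.
  set (kx := exp m * s / Gamma x). set (ky := exp m * (1 - s) / Gamma y).
  assert (Ex := RInt_correct _ _ _ (ex_RInt_Gamma_integrand x a b Hab)).
  assert (Ey := RInt_correct _ _ _ (ex_RInt_Gamma_integrand y a b Hab)).
  assert (HI := is_RInt_plus _ _ _ _ _ _ (is_RInt_scal _ _ _ kx _ Ex) (is_RInt_scal _ _ _ ky _ Ey)).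
  apply Rle_trans with (kx * RInt (Gamma_integrand x) a b + ky * RInt (Gamma_integrand y) a b).
  - rewrite <- (is_RInt_unique _ _ _ _ HI : _ = kx * RInt (Gamma_integrand x) a b
      + ky * RInt (Gamma_integrand y) a b).
    apply RInt_le; [lra|now apply ex_RInt_Gamma_integrand|eexists; exact HI|].
    intros t Ht. change (Gamma_integrand z t <= kx * Gamma_integrand x t + ky * Gamma_integrand y t).
    rewrite !Gamma_integrand_exp.
    assert (C := exp_convex s ((x - 1) * ln t - t - ln (Gamma x))
      ((y - 1) * ln t - t - ln (Gamma y)) Hs).
    replace ((z - 1) * ln t - t) with (m + (s * ((x - 1) * ln t - t - ln (Gamma x)) +
      (1 - s) * ((y - 1) * ln t - t - ln (Gamma y)))) by (unfold m, z; ring).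
    rewrite exp_plus.
    assert (D : forall u k, 0 < k -> exp (u - ln k) = exp u / k).
    { intros u k Hk. unfold Rminus. now rewrite exp_plus, exp_Ropp, exp_ln. }
    rewrite !D in C by assumption.
    apply Rmult_le_compat_l with (r := exp m) in C; [|apply Rlt_le, exp_pos].
    apply Rle_trans with (1 := C). right. unfold kx, ky. field. lra.
  - assert (Hkx : 0 <= kx).
    { unfold kx. apply Rmult_le_pos; [|apply Rlt_le, Rinv_0_lt_compat, Px].
      apply Rmult_le_pos; [apply Rlt_le, exp_pos|lra]. }
    assert (Hky : 0 <= ky).
    { unfold ky. apply Rmult_le_pos; [|apply Rlt_le, Rinv_0_lt_compat, Py].
      apply Rmult_le_pos; [apply Rlt_le, exp_pos|lra]. }
    apply Rle_trans with (kx * Gamma x + ky * Gamma y).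
    + apply Rplus_le_compat; apply Rmult_le_compat_l; try assumption; now apply RInt_le_Gamma.
    + right. unfold kx, ky. field. lra.
Qed.

(** [c - a] and [c - b] are the convex combinations of [c] and [c - a - b] with complementary
    weights, so the exponents from log-convexity add up to 1. *)
Lemma Gamma_prod_le (a b c : R) : 0 < a -> 0 < b -> a + b < c ->
  Gamma (c - a) * Gamma (c - b) <= Gamma c * Gamma (c - a - b).
Proof.
  intros Ha Hb Hc. set (s := b / (a + b)).
  assert (Hs : 0 <= s <= 1).
  { unfold s. split; [apply Rlt_le, Rdiv_lt_0_compat; lra|]. apply Rle_div_l; lra. }
  assert (H1 := Gamma_log_convex s c (c - a - b) ltac:(lra) ltac:(lra) Hs).
  assert (H2 := Gamma_log_convex (1 - s) c (c - a - b) ltac:(lra) ltac:(lra) ltac:(lra)).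
  replace (s * c + (1 - s) * (c - a - b)) with (c - a) in H1 by (unfold s; field; lra).
  replace ((1 - s) * c + (1 - (1 - s)) * (c - a - b)) with (c - b) in H2 by (unfold s; field; lra).
  assert (P1 := Gamma_pos (c - a) ltac:(lra)). assert (P2 := Gamma_pos (c - b) ltac:(lra)).
  apply Rle_trans with (1 := Rmult_le_compat _ _ _ _ (Rlt_le _ _ P1) (Rlt_le _ _ P2) H1 H2).
  right. rewrite <- exp_plus.
  rewrite <- (exp_ln (Gamma c)) at 3 by (apply Gamma_pos; lra).
  rewrite <- (exp_ln (Gamma (c - a - b))) at 3 by (apply Gamma_pos; lra).
  rewrite <- exp_plus. f_equal. ring.
Qed.

(** * The Gauss sum against the Gamma quotient *)

Definition Gamma_ratio (a b c : R) : R :=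
  Gamma c * Gamma (c - a - b) / (Gamma (c - a) * Gamma (c - b)).

Lemma Gamma_ratio_S (a b c : R) : 0 < a -> 0 < b -> a + b < c ->
  (c - a) * (c - b) * Gamma_ratio a b (c + 1) = c * (c - a - b) * Gamma_ratio a b c.
Proof.
  intros Ha Hb Hc. unfold Gamma_ratio.
  replace (c + 1 - a - b) with (c - a - b + 1) by ring.
  replace (c + 1 - a) with (c - a + 1) by ring. replace (c + 1 - b) with (c - b + 1) by ring.
  rewrite !Gamma_S by lra.
  generalize (Gamma_pos (c - a) ltac:(lra)) (Gamma_pos (c - b) ltac:(lra)). intros.
  field. lra.
Qed.

Lemma Gamma_ratio_ge_1 (a b c : R) : 0 < a -> 0 < b -> a + b < c -> 1 <= Gamma_ratio a b c.
Proof.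
  intros Ha Hb Hc. unfold Gamma_ratio.
  apply -> Rle_div_r; [|apply Rmult_lt_0_compat; apply Gamma_pos; lra].
  rewrite Rmult_1_l. now apply Gamma_prod_le.
Qed.

(* Both sides obey the same recurrence in c, the left one tends to 1 as c grows, and the
   right one stays at least 1 (equality is Gauss's summation theorem). *)
Lemma gauss_le_Gamma_ratio (a b c : R) : 0 < a -> 0 < b -> a + b < c ->
  gauss a b c <= Gamma_ratio a b c.
Proof.
  intros Ha Hb Hc.
  assert (Hinv : forall n, gauss a b (c + INR n) * Gamma_ratio a b c =
    gauss a b c * Gamma_ratio a b (c + INR n)).
  { induction n as [|n IH]; [simpl; rewrite Rplus_0_r; ring|].
    assert (Hn := pos_INR n). rewrite S_INR, <- Rplus_assoc.
    assert (E1 := gauss_contiguous_c a b (c + INR n) Ha Hb ltac:(lra)).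
    assert (E2 := Gamma_ratio_S a b (c + INR n) Ha Hb ltac:(lra)).
    apply Rmult_eq_reg_l with ((c + INR n - a) * (c + INR n - b)).
    - rewrite <- Rmult_assoc, E1.
      transitivity (gauss a b c * ((c + INR n - a) * (c + INR n - b) *
        Gamma_ratio a b (c + INR n + 1))); [|ring].
      rewrite E2.
      transitivity ((c + INR n) * (c + INR n - a - b) *
        (gauss a b (c + INR n) * Gamma_ratio a b c)); [ring|]. rewrite IH. ring.
    - apply Rgt_not_eq, Rmult_lt_0_compat; lra. }
  assert (HG := Gamma_ratio_ge_1 a b c Ha Hb Hc). assert (Hg := gauss_pos a b c Ha Hb Hc).
  replace (Gamma_ratio a b c)
    with ((1 + c * gauss a b c * 0) * Gamma_ratio a b c) by ring.
  apply is_lim_seq_ge_const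
    with (u := fun n => (1 + c * gauss a b c * / (c + INR n)) * Gamma_ratio a b c).
  - intros n. assert (Hn := pos_INR n).
    apply Rle_trans with (gauss a b c * Gamma_ratio a b (c + INR n)).
    + rewrite <- (Rmult_1_r (gauss a b c)) at 1. apply Rmult_le_compat_l; [lra|].
      apply Gamma_ratio_ge_1; lra.
    + rewrite <- Hinv. apply Rmult_le_compat_r; [lra|].
      apply Rle_trans with (1 := gauss_large_c a b c n Ha Hb Hc). right. field. lra.
  - apply (is_lim_seq_scal_r _ (Gamma_ratio a b c) (1 + c * gauss a b c * 0)).
    apply is_lim_seq_plus'; [apply is_lim_seq_const|].
    apply (is_lim_seq_scal_l _ (c * gauss a b c) 0).
    apply (is_lim_seq_inv _ p_infty); [|discriminate].
    apply is_lim_seq_le_p_loc with (2 := is_lim_seq_INR).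
    exists 0%nat. intros n _. lra.
Qed.
(** * The Clausen series *)

Lemma Cmod_poch_le (x : C) (n : nat) : Cmod (poch x n) <= rpoch (Cmod x) n.
Proof.
  induction n as [|n IH]; simpl; [rewrite Cmod_1; lra|].
  rewrite Cmod_mult. apply Rmult_le_compat; try apply Cmod_ge_0; [exact IH|].
  apply Rle_trans with (1 := Cmod_triangle _ _).
  rewrite Cmod_R, (Rabs_pos_eq _ (pos_INR n)). lra.
Qed.

Lemma poch_double (x : C) (n : nat) :
  poch x (2 * n) = (4 ^ n * (poch (x / 2) n * poch ((x + 1) / 2) n))%C.
Proof.
  induction n as [|n IH]; [simpl; ring|].
  replace (2 * S n)%nat with (S (S (2 * n))) by lia.
  assert (E : RtoC (INR (2 * n)) = (2 * INR n)%C) by (rewrite mult_INR, RtoC_mult; reflexivity).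
  change (poch x (S (S (2 * n))))
    with (poch x (2 * n) * (x + INR (2 * n)) * (x + INR (S (2 * n))))%C.
  rewrite IH, S_INR, RtoC_plus, E, Cpow_S. cbn [poch]. field.
Qed.

Lemma hyp3F2_coef_double (a b : C) (c : R) (n : nat) : 0 < c ->
  hyp3F2_coef a (b / 2) ((b + 1) / 2) (RtoC (c / 2)) (RtoC ((c + 1) / 2)) n =
  (poch a n * poch b (2 * n) / RtoC (rpoch c (2 * n) * INR (fact n)))%C.
Proof.
  intros Hc. unfold hyp3F2_coef.
  assert (E : RtoC (rpoch c (2 * n)) =
    (4 ^ n * (poch (RtoC (c / 2)) n * poch (RtoC ((c + 1) / 2)) n))%C).
  { rewrite <- rpoch_C, poch_double. do 2 f_equal; f_equal.
    - rewrite RtoC_div; [reflexivity|lra].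
    - rewrite RtoC_div, RtoC_plus; [reflexivity|lra]. }
  rewrite RtoC_mult, E, poch_double, !rpoch_C, rpoch_1.
  assert (N1 : RtoC (rpoch (c / 2) n) <> 0).
  { intros H. apply RtoC_inj in H. generalize (rpoch_pos (c / 2) n ltac:(lra)). lra. }
  assert (N2 : RtoC (rpoch ((c + 1) / 2) n) <> 0).
  { intros H. apply RtoC_inj in H. generalize (rpoch_pos ((c + 1) / 2) n ltac:(lra)). lra. }
  assert (N3 : RtoC (INR (fact n)) <> 0).
  { intros H. apply RtoC_inj in H. generalize (INR_fact_pos n). lra. }
  assert (N4 : (4 ^ n)%C <> 0).
  { rewrite <- RtoC_pow. intros H. apply RtoC_inj in H. revert H. apply pow_nonzero. lra. }
  field. repeat split; assumption.
Qed.

Lemma Cmod_hyp3F2_coef_le (a b : C) (c : R) (n : nat) : 0 < c ->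
  Cmod (hyp3F2_coef a (b / 2) ((b + 1) / 2) (RtoC (c / 2)) (RtoC ((c + 1) / 2)) n)
    <= quad_term (Cmod a) (Cmod b) c n.
Proof.
  intros Hc. rewrite hyp3F2_coef_double by exact Hc.
  assert (P : 0 < rpoch c (2 * n) * INR (fact n)).
  { apply Rmult_lt_0_compat; [now apply rpoch_pos|apply INR_fact_pos]. }
  rewrite Cmod_div, Cmod_R, (Rabs_pos_eq _ (Rlt_le _ _ P)), Cmod_mult.
  - unfold quad_term, Rdiv. apply Rmult_le_compat_r; [now apply Rlt_le, Rinv_0_lt_compat|].
    apply Rmult_le_compat; try apply Cmod_ge_0; apply Cmod_poch_le.
  - intros H. apply RtoC_inj in H. lra.
Qed.

Lemma quad_term_pos (a b c : R) (m : nat) : 0 < a -> 0 < b -> 0 < c -> 0 < quad_term a b c m.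
Proof.
  intros Ha Hb Hc. apply Rdiv_lt_0_compat; apply Rmult_lt_0_compat;
    auto using rpoch_pos, INR_fact_pos.
Qed.

Lemma quad_term_S (a b c : R) (m : nat) : 0 < c ->
  INR (S m) * quad_term a b c (S m) =
  a * (b * (b + 1)) / (c * (c + 1)) * quad_term (a + 1) (b + 2) (c + 2) m.
Proof.
  intros Hc. unfold quad_term.
  replace (2 * S m)%nat with (2 + 2 * m)%nat by lia.
  rewrite (rpoch_S_l a), (rpoch_add b), (rpoch_add c), fact_S_INR, S_INR.
  simpl (rpoch _ 2). simpl (INR 2). replace (1 + 1) with 2 by ring.
  generalize (rpoch_pos (c + 2) (2 * m) ltac:(lra)) (INR_fact_pos m) (pos_INR m). intros.
  field. lra.
Qed.

(** An inequality because lowering the index adds the nonnegative term of index [M + 1] on the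
    right. *)
Lemma sum_n_quad_weighted_le (a b c : R) (M : nat) : 0 < a -> 0 < b -> 0 < c ->
  sum_n (fun m => (2 * INR m + 1) * quad_term a b c m) M <=
  2 * (a * (b * (b + 1)) / (c * (c + 1))) * sum_n (quad_term (a + 1) (b + 2) (c + 2)) M
  + sum_n (quad_term a b c) M.
Proof.
  intros Ha Hb Hc.
  rewrite (sum_n_eqR _ (fun m => 2 * (INR m * quad_term a b c m) + quad_term a b c m))
    by (intros m _; ring).
  rewrite sum_n_plusR, sum_n_scalR. apply Rplus_le_compat_r.
  rewrite Rmult_assoc. apply Rmult_le_compat_l; [lra|].
  rewrite <- sum_n_scalR.
  rewrite <- (sum_n_eqR _ _ _ (fun m _ => quad_term_S a b c m Hc)).
  assert (H := sum_n_Sl (fun m => INR m * quad_term a b c m) M).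
  rewrite sum_n_SR in H. simpl (INR 0) in H.
  assert (0 <= INR (S M) * quad_term a b c (S M)).
  { apply Rmult_le_pos; [apply pos_INR|]. now apply Rlt_le, quad_term_pos. }
  lra.
Qed.

(** The sign cannot be read off an alternating, possibly divergent series; it follows from
    [sum_n_quad_le] at [M = 0], whose left side is positive. *)
Lemma hyp2F1_minus_one_nonneg (a b c : R) (F : C -> C) :
  0 < a -> 0 < b -> a + b < c ->
  is_hyp2F1 (RtoC a) (RtoC b) (RtoC (c - a)) F -> 0 <= Re (F (RtoC (- 1))).
Proof.
  intros Ha Hb Hc HF. assert (H := sum_n_quad_le a b c F 0 Ha Hb Hc HF).
  rewrite sum_O in H. assert (H1 := quad_term_pos a b c 0 Ha Hb ltac:(lra)).
  assert (H2 := gauss_pos a b c Ha Hb Hc).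
  apply Rmult_le_reg_l with (gauss a b c); [exact H2|]. lra.
Qed.

Lemma sum_n_quad_le_Gamma (a b c : R) (F : C -> C) (M : nat) :
  0 < a -> 0 < b -> a + b < c ->
  is_hyp2F1 (RtoC a) (RtoC b) (RtoC (c - a)) F ->
  sum_n (quad_term a b c) M <= Gamma_ratio a b c * Re (F (RtoC (- 1))).
Proof.
  intros Ha Hb Hc HF. apply Rle_trans with (1 := sum_n_quad_le a b c F M Ha Hb Hc HF).
  apply Rmult_le_compat_r; [now apply (hyp2F1_minus_one_nonneg a b c)|].
  now apply gauss_le_Gamma_ratio.
Qed.

(** The factor [c (c + 1)] cancels the one from [quad_term_S], which leaves precisely the
    coefficient of the first Gauss function in the hypothesis. *)
Lemma Gamma_ratio_shift (a b c : R) : 0 < a -> 0 < b -> a + b + 1 < c ->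
  Gamma_ratio (a + 1) (b + 2) (c + 2) =
  c * (c + 1) / ((c - a) * (c - a - b - 1)) * Gamma_ratio a b c.
Proof.
  intros Ha Hb Hc. unfold Gamma_ratio.
  replace (c + 2) with (c + 1 + 1) by ring.
  replace (c + 1 + 1 - (a + 1)) with (c - a + 1) by ring.
  replace (c - a + 1 - (b + 2)) with (c - a - b - 1) by ring.
  replace (c + 1 + 1 - (b + 2)) with (c - b) by ring.
  assert (E : Gamma (c - a - b) = (c - a - b - 1) * Gamma (c - a - b - 1)).
  { rewrite <- Gamma_S by lra. f_equal. ring. }
  rewrite E, !Gamma_S by lra.
  generalize (Gamma_pos (c - a) ltac:(lra)) (Gamma_pos (c - b) ltac:(lra)). intros.
  field. lra.
Qed.

(* F1 and F2 are the two Gauss functions of the hypothesis. Their parameters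
   are real, so their values at -1 are real and Re only converts C to R. *)
Theorem theorem5p1 (a b : C) (c : R) (F1 F2 : C -> C)
  (ha : a <> RtoC 0) (hb : b <> RtoC 0)
  (hc0 : 0 < c) (hc : Cmod a + Cmod b + 1 < c)
  (hF1 : is_hyp2F1 (Cmod a + 1)%C (Cmod b + 2)%C (c - Cmod a + 1)%C F1)
  (hF2 : is_hyp2F1 (Cmod a) (Cmod b) (c - Cmod a)%C F2)
  (hle : Gamma c * Gamma (c - Cmod a - Cmod b)
           / (Gamma (c - Cmod a) * Gamma (c - Cmod b))
         * Re (2 * Cmod a * poch (Cmod b) 2
                 / ((c - Cmod a) * (c - Cmod a - Cmod b - 1)) * F1 (- (1))
               + F2 (- (1)))%C
         <= 2) :
  class_Sp (fun z => (z * hyp3F2 a (b / 2) ((b + 1) / 2) (RtoC (c / 2)) (RtoC ((c + 1) / 2)) z)%C).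
Proof.
  apply Cmod_gt_0 in ha. apply Cmod_gt_0 in hb.
  set (g := hyp3F2_coef a (b / 2) ((b + 1) / 2) (RtoC (c / 2)) (RtoC ((c + 1) / 2))).
  assert (Hg : forall n, Cmod (g n) <= quad_term (Cmod a) (Cmod b) c n)
    by (intros n; now apply Cmod_hyp3F2_coef_le).
  set (A := Cmod a) in *. set (B := Cmod b) in *.
  replace (- (1))%C with (RtoC (- 1)) in hle by (rewrite <- RtoC_opp; reflexivity).
  replace (2 * A * poch B 2 / ((c - A) * (c - A - B - 1)))%C
    with (RtoC (2 * A * (B * (B + 1)) / ((c - A) * (c - A - B - 1)))) in hle.
  2:{ rewrite RtoC_div.
      - rewrite rpoch_C. simpl rpoch.
        rewrite !RtoC_mult, !RtoC_minus, !RtoC_plus. f_equal. ring.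
      - apply Rgt_not_eq, Rmult_lt_0_compat; lra. }
  assert (HRe : forall (k : R) (u v : C), Re (k * u + v)%C = k * Re u + Re v).
  { intros k u v. unfold Re. simpl. ring. }
  rewrite HRe in hle.
  assert (G2 := fun M => sum_n_quad_le_Gamma A B c F2 M ha hb ltac:(lra)
    ltac:(rewrite RtoC_minus; exact hF2)).
  assert (G1 := fun M => sum_n_quad_le_Gamma (A + 1) (B + 2) (c + 2) F1 M ltac:(lra) ltac:(lra)
    ltac:(lra) ltac:(replace (c + 2 - (A + 1)) with (c - A + 1) by ring;
      rewrite !RtoC_plus, RtoC_minus; exact hF1)).
  rewrite Gamma_ratio_shift in G1 by lra.
  assert (Hsum : forall M, sum_n (fun m => (2 * INR m + 1) * quad_term A B c m) M <= 2).
  { intros M. apply Rle_trans with (1 := sum_n_quad_weighted_le A B c M ha hb hc0).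
    apply Rle_trans with (2 := hle). fold (Gamma_ratio A B c).
    set (k := 2 * (A * (B * (B + 1)) / (c * (c + 1)))).
    assert (Hk : 0 <= k).
    { unfold k. apply Rmult_le_pos; [lra|]. apply Rlt_le, Rdiv_lt_0_compat;
        repeat apply Rmult_lt_0_compat; lra. }
    apply Rle_trans with (1 := Rplus_le_compat _ _ _ _ (Rmult_le_compat_l k _ _ Hk (G1 M)) (G2 M)).
    right. unfold k. field. repeat split; lra. }
  assert (HW : forall M, sum_n (fun n => (2 * INR n + 3) * Cmod (g (S n))) M <= 1).
  { intros M. assert (H := Hsum (S M)). rewrite sum_n_Sl in H.
    unfold quad_term in H at 1. simpl in H.
    assert (H0 : sum_n (fun n => (2 * INR n + 3) * Cmod (g (S n))) M <=
      sum_n (fun n => (2 * INR (S n) + 1) * quad_term A B c (S n)) M).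
    { apply sum_n_m_le. intros n. rewrite S_INR.
      replace (2 * (INR n + 1) + 1) with (2 * INR n + 3) by ring.
      apply Rmult_le_compat_l; [generalize (pos_INR n); lra|apply Hg]. }
    apply Rle_trans with (1 := H0). apply Rplus_le_reg_l with 1.
    apply Rle_trans with (2 := H). right. f_equal. field. }
  assert (HWex : ex_series (fun n => (2 * INR n + 3) * Cmod (g (S n)))).
  { apply ex_series_pos_bounded with (2 := HW). intros n.
    apply Rmult_le_pos; [generalize (pos_INR n); lra|apply Cmod_ge_0]. }
  assert (HWle : Series (fun n => (2 * INR n + 3) * Cmod (g (S n))) <= 1).
  { apply (is_lim_seq_le _ (fun _ => 1) (Series _) 1 HW (Series_correct _ HWex)).
    apply is_lim_seq_const. }
  assert (Hg0 : g 0%nat = RtoC 1) by (unfold g, hyp3F2_coef; simpl; field).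
  apply (class_Sp_of_small_coef g Hg0 HWex HWle). intros z Hz. f_equal.
  unfold hyp3F2. fold g.
  assert (Hs := is_pseries_PS g z (small_coef_summable g HWex) Hz).
  (* [hyp3F2] is a definite description, so the sum of the series must be shown unique as well as
     attained. *)
  apply (iota_unique (V := C_CompleteNormedModule)); [|exact Hs].
  intros y Hy. exact (is_cseries_unique _ _ _ Hy Hs).
Qed.
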